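(* For every HyperLTL sentence $\varphi$ one can compute in polynomial time a HyperLTL sentence $\varphi'$ of the form $\forall\pi_1.\forall\pi_2.\exists\tau_1\cdots\exists\tau_m.\psi$ (with $\psi$ quantifier-free) and temporal depth at most two such that $\varphi$ is satisfiable if and only if $\varphi'$ is satisfiable.
   Context: HyperLTL formulas over a finite set $AP$ of propositions are in prenex form: $\phi ::= \exists\pi.\phi \mid \forall\pi.\phi \mid \psi$, $\psi ::= a_\pi \mid \neg\psi \mid \psi\vee\psi \mid \mathbf{X}\psi \mid \psi\,\mathbf{U}\,\psi$ (derived $\mathbf{F},\mathbf{G},\wedge,\Rightarrow,\Leftrightarrow$). Semantics over a set $T$ of traces (infinite sequences of subsets of $AP$): quantifiers range over $T$, $a_\pi$ holds iff $a$ is in the current position of the trace assigned to $\pi$, and $\mathbf{X},\mathbf{U}$ shift all assigned traces synchronously. A sentence is satisfiable if it has a nonempty model $T$. The atomic propositions of $\varphi'$ may range over a larger set than those of $\varphi$. Temporal depth: $\mathrm{td}(a_\pi)=0$, Boolean connectives take the maximum, $\mathrm{td}(\mathbf{X}\psi)=1+\mathrm{td}(\psi)$, $\mathrm{td}(\psi_1\mathbf{U}\psi_2)=1+\max(\mathrm{td}(\psi_1),\mathrm{td}(\psi_2))$, quantifiers do not change it. *)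

(* Defs.v *)
(* MathComp world, with finmap for finite sets over a countable type. *)
From HB Require Import structures.
From mathcomp Require Import all_boot all_algebra finmap.

Set Implicit Arguments.
Unset Strict Implicit.
Unset Printing Implicit Defensive.

(** * HyperLTL *)

(* Atomic propositions and trace variables are identifiers over {0,1}: a
   countably infinite supply of names, where the length of a name is part of
   the size of a formula.  The two uses live in separate namespaces. *)
Definition name : Type := seq bool.

Inductive body : Type :=
| Atom (a pi : name)
| Neg (psi : body)
| Or (psi1 psi2 : body)
| Next (psi : body)
| Until (psi1 psi2 : body).

Inductive hyperltl : Type :=
| Exists (pi : name) (phi : hyperltl)
| Forall (pi : name) (phi : hyperltl)
| Body (psi : body).

Fixpoint body_closed (bound : seq name) (psi : body) : bool :=
  match psi with
  | Atom _ pi => pi \in bound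
  | Neg psi1 | Next psi1 => body_closed bound psi1
  | Or psi1 psi2 | Until psi1 psi2 =>
      body_closed bound psi1 && body_closed bound psi2
  end.

Fixpoint closed (bound : seq name) (phi : hyperltl) : bool :=
  match phi with
  | Exists pi phi1 | Forall pi phi1 => closed (pi :: bound) phi1
  | Body psi => body_closed bound psi
  end.

Record sentence : Type := Sentence {
  sentence_val :> hyperltl;
  sentence_closed : closed [::] sentence_val
}.

Fixpoint body_props (psi : body) : {fset name} :=
  match psi with
  | Atom a _ => [fset a]%fset
  | Neg psi1 | Next psi1 => body_props psi1
  | Or psi1 psi2 | Until psi1 psi2 =>
      (body_props psi1 `|` body_props psi2)%fset
  end.

Fixpoint props (phi : hyperltl) : {fset name} :=
  match phi with
  | Exists _ phi1 | Forall _ phi1 => props phi1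
  | Body psi => body_props psi
  end.

Fixpoint body_td (psi : body) : nat :=
  match psi with
  | Atom _ _ => 0
  | Neg psi1 => body_td psi1
  | Or psi1 psi2 => maxn (body_td psi1) (body_td psi2)
  | Next psi1 => (body_td psi1).+1
  | Until psi1 psi2 => (maxn (body_td psi1) (body_td psi2)).+1
  end.

Fixpoint td (phi : hyperltl) : nat :=
  match phi with
  | Exists _ phi1 | Forall _ phi1 => td phi1
  | Body psi => body_td psi
  end.

Definition trace : Type := nat -> {fset name}.

Definition trace_over (AP : {fset name}) (t : trace) : Prop :=
  forall i, (t i `<=` AP)%fset.

Definition assignment : Type := name -> option trace.

Definition empty_assignment : assignment := fun=> None.

Definition update (Pi : assignment) (pi : name) (t : trace) : assignment :=
  fun pi' => if pi' == pi then Some t else Pi pi'.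

(* The suffix, from position j on, of every assigned trace. *)
Definition shift (j : nat) (Pi : assignment) : assignment :=
  fun pi => omap (fun (t : trace) i => t (j + i)) (Pi pi).

Fixpoint body_sat (Pi : assignment) (psi : body) : Prop :=
  match psi with
  | Atom a pi => exists2 t, Pi pi = Some t & a \in t 0
  | Neg psi1 => ~ body_sat Pi psi1
  | Or psi1 psi2 => body_sat Pi psi1 \/ body_sat Pi psi2
  | Next psi1 => body_sat (shift 1 Pi) psi1
  | Until psi1 psi2 => exists2 j, body_sat (shift j Pi) psi2 &
      forall i, i < j -> body_sat (shift i Pi) psi1
  end.

Fixpoint sat (T : trace -> Prop) (Pi : assignment) (phi : hyperltl) : Prop :=
  match phi with
  | Exists pi phi1 => exists2 t, T t & sat T (update Pi pi t) phi1
  | Forall pi phi1 => forall t, T t -> sat T (update Pi pi t) phi1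
  | Body psi => body_sat Pi psi
  end.

Definition satisfiable (AP : {fset name}) (phi : sentence) : Prop :=
  exists T : trace -> Prop,
    [/\ exists t, T t,
        forall t, T t -> trace_over AP t &
        sat T empty_assignment phi].

(* No repetition among the variables: otherwise shadowing would hide some of
   the displayed quantifiers. *)
Definition forall2_exists_form (phi : hyperltl) : Prop :=
  exists (pi1 pi2 : name) (taus : seq name) (psi : body),
    uniq [:: pi1, pi2 & taus] /\
    phi = Forall pi1 (Forall pi2 (foldr Exists (Body psi) taus)).

(** * Polynomial-time computability *)

(* Deterministic Turing machines with finitely many (and at least one)
   two-way infinite tapes.  A cell contains an input/output symbol of Sigma, a
   work symbol, or None, the blank. *)
Inductive move : Type := MoveLeft | Stay | MoveRight.

Record machine (Sigma : finType) : Type := Machine {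
  state : finType;
  work : finType;
  extra_tapes : nat;
  start : state;
  halting : pred state;
  delta : state ->
    {ffun 'I_extra_tapes.+1 -> option (Sigma + work)} ->
    'I_extra_tapes.+1 -> option (Sigma + work) * move;
  next_state : state ->
    {ffun 'I_extra_tapes.+1 -> option (Sigma + work)} -> state
}.

Section Machine.
Variables (Sigma : finType) (M : machine Sigma).

Definition cell : Type := option (Sigma + work M).

(* The pair (l, r) is the tape whose cells left of the head are l, the nearest
   one first, and whose cells from the scanned one on are r; all the cells
   beyond l and r are blank. *)
Definition tape : Type := (seq cell * seq cell)%type.

Definition scanned (t : tape) : cell := head None t.2.

Definition act (t : tape) (a : cell * move) : tape :=
  match a.2 with
  | MoveLeft => (behead t.1, head None t.1 :: a.1 :: behead t.2)
  | Stay => (t.1, a.1 :: behead t.2)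
  | MoveRight => (a.1 :: t.1, behead t.2)
  end.

Definition config : Type :=
  (state M * ('I_(extra_tapes M).+1 -> tape))%type.

Definition step (c : config) : config :=
  if halting c.1 then c else
  let read := [ffun i => scanned (c.2 i)] in
  (next_state c.1 read, fun i => act (c.2 i) (delta c.1 read i)).

Definition word (w : seq Sigma) : seq cell := [seq Some (inl s) | s <- w].

Definition init (w : seq Sigma) : config :=
  (start M, fun i => ([::], if i == ord0 then word w else [::])).

(* Starting at the head, the tape contains w followed by a blank. *)
Definition shows (t : tape) (w : seq Sigma) : Prop :=
  forall i, i <= size w -> nth None t.2 i = nth None (word w) i.

(* Halting configurations are fixed points of step, so the machine halts after
   at most n steps. *)
Definition outputs_within (n : nat) (w w' : seq Sigma) : Prop :=
  let c := iter n step (init w) in halting c.1 /\ shows (c.2 ord0) w'.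

End Machine.

Definition polytime_computable (Sigma : finType) (A B : Type)
    (encA : A -> seq Sigma) (encB : B -> seq Sigma) (f : A -> B) : Prop :=
  exists (M : machine Sigma) (p : {poly nat}),
    forall x : A,
      outputs_within M (p.[size (encA x)])%R (encA x) (encB (f x)).

(** * Formulas as words: Polish notation, names in binary *)

Inductive token : Type :=
  TExists | TForall | TAtom | TNeg | TOr | TNext | TUntil | TBit of bool | TEnd.

Definition token_code (s : token) : 'I_10 :=
  inord match s with
  | TExists => 0 | TForall => 1 | TAtom => 2 | TNeg => 3 | TOr => 4
  | TNext => 5 | TUntil => 6 | TBit b => 7 + b | TEnd => 9
  end.

Definition token_decode (i : 'I_10) : token :=
  nth TEnd [:: TExists; TForall; TAtom; TNeg; TOr; TNext; TUntil;
               TBit false; TBit true] i.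

Lemma token_codeK : cancel token_code token_decode.
Proof. by case=> [||||||| []|]; rewrite /token_decode inordK. Qed.

HB.instance Definition _ := Finite.copy token (can_type token_codeK).

Definition encode_name (x : name) : seq token :=
  rcons [seq TBit b | b <- x] TEnd.

Fixpoint encode_body (psi : body) : seq token :=
  match psi with
  | Atom a pi => TAtom :: encode_name a ++ encode_name pi
  | Neg psi1 => TNeg :: encode_body psi1
  | Or psi1 psi2 => TOr :: encode_body psi1 ++ encode_body psi2
  | Next psi1 => TNext :: encode_body psi1
  | Until psi1 psi2 => TUntil :: encode_body psi1 ++ encode_body psi2
  end.

Fixpoint encode (phi : hyperltl) : seq token :=
  match phi with
  | Exists pi phi1 => TExists :: encode_name pi ++ encode phi1
  | Forall pi phi1 => TForall :: encode_name pi ++ encode phi1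
  | Body psi => encode_body psi
  end.

Definition encode_sentence (phi : sentence) : seq token := encode phi.

Lemma encode_name_inj x y u v :
  encode_name x ++ u = encode_name y ++ v -> x = y /\ u = v.
Proof.
elim: x y => [|b x IHx] [|c y] //=; first by case=> ->.
by case=> -> /IHx[-> ->].
Qed.

Lemma encode_body_inj psi psi' u v :
  encode_body psi ++ u = encode_body psi' ++ v -> psi = psi' /\ u = v.
Proof.
elim: psi psi' u v => [a pi|p IH|p IHp q IHq|p IH|p IHp q IHq]
  [a' pi'|p'|p' q'|p'|p' q'] u v //= [].
- by rewrite -!catA => /encode_name_inj[-> /encode_name_inj[-> ->]].
- by case/IH=> -> ->.
- by rewrite -!catA => /IHp[-> /IHq[-> ->]].
- by case/IH=> -> ->.
- by rewrite -!catA => /IHp[-> /IHq[-> ->]].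
Qed.

Lemma encode_inj : injective encode.
Proof.
elim=> [pi p IH|pi p IH|p] [pi' p'|pi' p'|p'] //=; try by case: p.
- by case=> /encode_name_inj[-> /IH ->].
- by case: p'.
- by case=> /encode_name_inj[-> /IH ->].
- by case: p'.
- by move=> E; have [] := @encode_body_inj p p' [::] [::]; rewrite ?E // => ->.
Qed.

(* Main.v *)
Require Import Defs.
From mathcomp Require Import all_boot all_algebra finmap boolp.

Set Implicit Arguments.
Unset Strict Implicit.
Unset Printing Implicit Defensive.

(* A trace of a model of the new sentence stores a trace of the old model, an
   assignment of traces to variables, a position in the given formula, namely
   that of a subformula which the assignment satisfies, and the truth values of
   the quantifier-free part under the assignment.  The body says of p, q and t:
   if the position of p is at a quantifier over pi, then t stands one quantifier
   further and its assignment is that of p with pi mapped to the trace stored in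
   q or, for an existential quantifier, to the one stored in t itself; if it is
   at the quantifier-free part, then that part is true.  The last variable i
   provides a trace at the start.  Truth values are indexed by positions of the
   formula in Polish notation, read from right to left, and stack depths; so
   each of them is constrained locally, with temporal depth two, and nothing
   has to be parsed.

   The translation consists of nested loops over the positions of the input.  It
   is computed by a program which moves heads on read-only copies of the input;
   such a program stops after polynomially many steps if it stops at all, since
   no control point is met twice with the same head positions. *)

(** * Multi-head transducers *)

Definition sym : Type := option (token + bool).
Definition lend : sym := Some (inr false).
Definition rend : sym := Some (inr true).

Inductive instr : Type := Nop | Out of token | GoL of nat | GoR of nat.

Inductive prog : Type :=
| Do of instr
| Seq of prog & prog
| If of (seq sym -> bool) & prog & prog
| While of (seq sym -> bool) & prog.

(** Control points form a finite type, so that they can serve as machine states; [None] is the test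
    of a conditional or of a loop. *)
Fixpoint pc (c : prog) : finType :=
  match c with
  | Do _ => unit
  | Seq a b => (pc a + pc b)%type
  | If _ a b => option (pc a + pc b)%type
  | While _ a => option (pc a)
  end.

Fixpoint entry (c : prog) : pc c :=
  match c with
  | Do _ => tt
  | Seq a b => inl (entry a)
  | If _ _ _ => None
  | While _ _ => None
  end.

(* The next control point None means that the program is left. *)
Fixpoint exec (c : prog) : pc c -> seq sym -> instr * option (pc c) :=
  match c return pc c -> seq sym -> instr * option (pc c) with
  | Do i => fun _ _ => (i, None)
  | Seq a b => fun s r =>
      match s with
      | inl s1 => let: (i, n) := exec s1 r in
          (i, Some (if n is Some s2 then inl s2 else inr (entry b)))
      | inr s1 => let: (i, n) := exec s1 r in (i, omap inr n)
      end
  | If t a b => fun s r =>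
      match s with
      | None => (Nop, Some (Some (if t r then inl (entry a) else inr (entry b))))
      | Some (inl s1) => let: (i, n) := exec s1 r in
          (i, omap (fun x => Some (inl x)) n)
      | Some (inr s1) => let: (i, n) := exec s1 r in
          (i, omap (fun x => Some (inr x)) n)
      end
  | While t a => fun s r =>
      match s with
      | None => (Nop, if t r then Some (Some (entry a)) else None)
      | Some s1 => let: (i, n) := exec s1 r in (i, Some n)
      end
  end.

Fixpoint upd (f : nat -> nat) (ps : seq nat) (h : nat) : seq nat :=
  match ps, h with
  | [::], _ => [::]
  | p :: ps', 0 => f p :: ps'
  | p :: ps', h'.+1 => p :: upd f ps' h'
  end.

Lemma size_upd f ps h : size (upd f ps h) = size ps.
Proof. by elim: ps h => [|p ps IH] [|h] //=; rewrite IH. Qed.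

Lemma nth_upd f ps h i : i < size ps ->
  nth 0 (upd f ps h) i = if i == h then f (nth 0 ps i) else nth 0 ps i.
Proof. by elim: ps h i => [|p ps IH] [|h] [|i] //= lti; rewrite IH. Qed.

Lemma all_upd (P : pred nat) f ps h :
  (forall p, P p -> P (f p)) -> all P ps -> all P (upd f ps h).
Proof.
move=> Pf; elim: ps h => [|p ps IH] [|h] //= /andP[Pp Pps].
  by rewrite Pf.
by rewrite Pp IH.
Qed.

(** * Runs of a program and a bound on their length *)

Section Runs.
Variable u : seq sym.

Definition syms (ps : seq nat) : seq sym := [seq nth None u p | p <- ps].

(** Heads stop at both ends of the word, so no instruction makes a valid position invalid. *)
Definition goL (p : nat) : nat := p.-1.
Definition goR (p : nat) : nat := minn p.+1 (size u).-1.

Definition eff (i : instr) (s : seq nat * seq token) : seq nat * seq token :=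
  match i with
  | Nop => s
  | Out x => (s.1, x :: s.2)
  | GoL h => (upd goL s.1 h, s.2)
  | GoR h => (upd goR s.1 h, s.2)
  end.

Inductive run (c : prog) :
  pc c -> nat -> seq nat * seq token -> seq nat * seq token -> Prop :=
| run_exit s i st : exec s (syms st.1) = (i, None) -> run s 1 st (eff i st)
| run_step s s' i m st st' : exec s (syms st.1) = (i, Some s') ->
    run s' m (eff i st) st' -> run s m.+1 st st'.

Definition runs (c : prog) st st' : Prop := exists m, run (entry c) m st st'.

(** This serves where leaving the part means leaving the whole: the second half of a sequence and
    both branches of a conditional. Where control passes on instead, the induction is done
    afresh. *)
Lemma run_embed c d (f : pc c -> pc d) (s : pc c) m st st' :
  (forall s r, exec (f s) r = let: (i, n) := exec s r in (i, omap f n)) ->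
  run s m st st' -> run (f s) m st st'.
Proof.
move=> Ef; elim=> {s m st st'} [s i st E|s s' i m st st' E _ IH].
  by apply: run_exit; rewrite Ef E.
by apply: (run_step _ IH); rewrite Ef E.
Qed.

Lemma runs_do i st : runs (Do i) st (eff i st).
Proof. by exists 1; apply: run_exit. Qed.

Lemma runs_seq a b st1 st2 st3 :
  runs a st1 st2 -> runs b st2 st3 -> runs (Seq a b) st1 st3.
Proof.
move=> [m run1] [m' run2'].
have {run2'} run2 := @run_embed _ (Seq a b) inr _ _ _ _ (fun _ _ => erefl) run2'.
exists (m + m'); rewrite /=.
elim: {m st1 st2} run1 run2 => [s i st E|s s' i m st st' E _ IH] run2.
  by apply: (@run_step (Seq a b) (inl s) _ i) run2; rewrite /= E.
by apply: (@run_step (Seq a b) (inl s) _ i _ _ _ _ (IH run2)); rewrite /= E.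
Qed.

Lemma runs_if t a b st st' :
  runs (if t (syms st.1) then a else b) st st' -> runs (If t a b) st st'.
Proof.
case: ifP => [tt|tf] [m H]; exists m.+1; rewrite /=.
  apply: (@run_step (If t a b) None (Some (inl (entry a))) Nop).
    by rewrite /= tt.
  exact: (@run_embed _ (If t a b) (fun s => Some (inl s))).
apply: (@run_step (If t a b) None (Some (inr (entry b))) Nop).
  by rewrite /= tf.
exact: (@run_embed _ (If t a b) (fun s => Some (inr s))).
Qed.

Lemma runs_while0 t a st : t (syms st.1) = false -> runs (While t a) st st.
Proof.
move=> tf; exists 1; rewrite /=.
have -> : st = eff Nop st by [].
by apply: (@run_exit (While t a)); rewrite /= tf.
Qed.

Lemma runs_while1 (t : seq sym -> bool) a st1 st2 st3 : t (syms st1.1) ->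
  runs a st1 st2 -> runs (While t a) st2 st3 -> runs (While t a) st1 st3.
Proof.
move=> tt [m H] [m' H']; exists (m + m').+1; rewrite /=.
apply: (@run_step (While t a) None (Some (entry a)) Nop); first by rewrite /= tt.
elim: {tt m st1 st2} H H' => [s i st E|s s' i m st st' E _ IH] H'.
  by apply: (@run_step (While t a) (Some s) None i) H'; rewrite /= E.
by apply: (@run_step (While t a) (Some s) (Some s') i _ _ _ _ (IH H'));
  rewrite /= E.
Qed.

Lemma runP c (s : pc c) m st st' : run s m st st' ->
  (exists i, [/\ m = 1, exec s (syms st.1) = (i, None) & st' = eff i st]) \/
  exists i s' m', [/\ m = m'.+1, exec s (syms st.1) = (i, Some s') &
    run s' m' (eff i st) st'].
Proof.
case=> {s m st st'} [s i st E|s s' i m st st' E H]; first by left; exists i.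
by right; exists i, s', m.
Qed.

(** Tests read the heads and never the output, so two runs that differ only in their output take the
    same branches. *)
Lemma run_det c (s : pc c) m m' ps o o' st st' :
  run s m (ps, o) st -> run s m' (ps, o') st' -> m = m'.
Proof.
elim: m s m' ps o o' st st' => [|m IH] s m' ps o o' st st'.
  by case/runP=> [[? []]|[? [? [? []]]]].
case/runP=> [[i [-> /= E _]]|[i [s1 [m1 [[<-] /= E H]]]]].
  by case/runP=> [[? []]|[? [? [? [_ /=]]]]] //; rewrite E.
case/runP=> [[? [_ /=]]|[i' [s1' [m1' [-> /= + H']]]]]; rewrite E // => -[Ei Es].
subst i' s1'; congr _.+1.
by case: i {E} H H' => [|x|h|h] /= H H'; apply: IH H H'.
Qed.

Definition valid (ps : seq nat) := all (fun p => p < size u) ps.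

Lemma goR_lt p : p < size u -> goR p < size u.
Proof.
rewrite /goR => lt_p; apply: leq_ltn_trans (geq_minr _ _) _.
by case: (size u) lt_p.
Qed.

Lemma valid_eff i st : valid st.1 -> valid (eff i st).1.
Proof.
case: i => [|x|h|h] //= V; apply: all_upd V => p; last exact: goR_lt.
by apply: leq_ltn_trans; rewrite /goL leq_pred.
Qed.

Lemma size_eff i st : size (eff i st).1 = size st.1.
Proof. by case: i => [|x|h|h] //=; rewrite size_upd. Qed.

(* A control point together with head positions determines the remaining
   running time, so that no such pair is repeated. *)
Lemma run_time c (s : pc c) m ps o st' : 0 < size u -> valid ps ->
  run s m (ps, o) st' -> m <= #|pc c| * size u ^ size ps.
Proof.
case EN: (size u) => [//|N] _ V R; move Sk: (size ps) => k.
pose P m' (x : pc c * seq nat) := [/\ valid x.2, size x.2 = k &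
  exists o' st0, run x.1 m' (x.2, o') st0].
(* [l] lists the pairs met during the run, each with a remaining time of at most [m]. *)
have [l [Ul Sl Pl]] : exists l : seq (pc c * seq nat),
    [/\ uniq l, size l = m & forall x, x \in l -> exists2 m', m' <= m & P m' x].
  elim: m s ps o V R Sk => [|m IH] s ps o V R Sk; first by exists [::].
  have Ps : P m.+1 (s, ps) by split=> //; exists o, st'.
  case: (runP R) => [[_ [[m0] _ _]]|[i [s' [m' [[<-] E R']]]]].
    exists [:: (s, ps)]; split=> [||x] //; first by rewrite m0.
    rewrite inE => /eqP ->.
    by exists 1 => //; move: Ps; rewrite m0.
  have [] := IH s' (eff i (ps, o)).1 (eff i (ps, o)).2.
  - exact: valid_eff.
  - by case: (eff i _) R'.
  - by rewrite size_eff.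
  move=> l [Ul Sl Pl]; exists ((s, ps) :: l); split=> [/=||x]; last 1 first.
  - rewrite inE => /predU1P[->|/Pl[m1 le1 P1]]; first by exists m.+1.
    by exists m1 => //; apply: leqW.
  (* If the first pair came back later, [run_det] would make its remaining time both [m.+1] and at
     most [m]. *)
  - rewrite Ul andbT; apply/negP => /Pl[m1 le1 [_ _ [o1 [st1 R1]]]].
    by move: le1; rewrite -(run_det R R1) ltnn.
  - by rewrite /= Sl.
(* [inord] loses nothing on valid positions, so the pairs met embed into a finite type of the
   required cardinality. *)
pose g (x : pc c * seq nat) : pc c * k.-tuple 'I_N.+1 :=
  (x.1, [tuple inord (nth 0 x.2 i) | i < k]).
have Ig : {in l &, injective g}.
  move=> [s1 p1] [s2 p2] /Pl[_ _ [/= V1 S1 _]] /Pl[_ _ [/= V2 S2 _]] E.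
  have /= -> := congr1 fst E; congr pair.
  apply: (@eq_from_nth _ 0); rewrite S1 ?S2 // => i lt_i.
  have := congr1 (fun x => val (tnth x.2 (Ordinal lt_i))) E.
  rewrite !tnth_mktuple; rewrite /= !inordK //.
    by rewrite -EN; apply: (allP V2); rewrite mem_nth ?S2.
  by rewrite -EN; apply: (allP V1); rewrite mem_nth ?S1.
have := max_card [in [seq g x | x <- l]].
have /card_uniqP -> : uniq [seq g x | x <- l] by rewrite map_inj_in_uniq.
by rewrite size_map Sl card_prod card_tuple card_ord.
Qed.

End Runs.

(** * Simulation of a program by a Turing machine *)

Definition tape_word (w : seq token) : seq sym :=
  lend :: rcons [seq Some (inl x) | x <- w] rend.

Lemma size_tape_word w : size (tape_word w) = (size w).+2.
Proof. by rewrite /= size_rcons size_map. Qed.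

Section Machine.
Variables (k : nat) (c : prog).

(** The left summand only supplies five names: four phases around the program, and the halting
    one. *)
Definition phase : finType := (option (bool * bool) + pc c)%type.
Definition ph_start : phase := inl (Some (false, false)).
Definition ph_copy : phase := inl (Some (false, true)).
Definition ph_rewind : phase := inl (Some (true, false)).
Definition ph_finish : phase := inl (Some (true, true)).
Definition ph_halted : phase := inl None.

Definition input_syms (r : {ffun 'I_k.+1 -> sym}) : seq sym :=
  [seq r (lift ord0 i) | i <- enum 'I_k].

(* Tape 0 is copied to the other tapes between end markers and erased; the
   output is then written on it from right to left. *)
Definition tr_delta (s : phase) (r : {ffun 'I_k.+1 -> sym}) (j : 'I_k.+1) :
    sym * move :=
  match s with
  | inl (Some (false, false)) =>
      if j == ord0 then (r j, Stay) else (lend, MoveRight)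
  | inl (Some (false, true)) =>
      if r ord0 is Some _ then (if j == ord0 then None else r ord0, MoveRight)
      else (if j == ord0 then None else rend, Stay)
  | inl (Some (true, false)) =>
      if (j == ord0) || (r j == lend) then (r j, Stay) else (r j, MoveLeft)
  | inl (Some (true, true)) =>
      (r j, if j == ord0 then MoveRight else Stay)
  | inl None => (r j, Stay)
  | inr s1 =>
      match (exec s1 (input_syms r)).1 with
      | Nop => (r j, Stay)
      | Out x => if j == ord0 then (Some (inl x), MoveLeft) else (r j, Stay)
      | GoL h =>
          (r j, if (j == h.+1 :> nat) && (r j != lend) then MoveLeft else Stay)
      | GoR h =>
          (r j, if (j == h.+1 :> nat) && (r j != rend) then MoveRight else Stay)
      end
  end.

Definition tr_next (s : phase) (r : {ffun 'I_k.+1 -> sym}) : phase :=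
  match s with
  | inl (Some (false, false)) => ph_copy
  | inl (Some (false, true)) => if r ord0 is Some _ then ph_copy else ph_rewind
  | inl (Some (true, false)) =>
      if head lend (input_syms r) == lend then inr (entry c) else ph_rewind
  | inl (Some (true, true)) => ph_halted
  | inl None => ph_halted
  | inr s1 =>
      if (exec s1 (input_syms r)).2 is Some s2 then inr s2 else ph_finish
  end.

Definition tr_machine : machine token :=
  @Machine token phase bool k ph_start (fun s => s == ph_halted)
    tr_delta tr_next.

(** The pair [(rev (take p v), drop p v)] is the tape with content [v] and its head on position
    [p]. *)
Lemma act_stay (v : seq sym) p : p < size v ->
  act (M := tr_machine) (rev (take p v), drop p v) (nth None v p, Stay) =
  (rev (take p v), drop p v).
Proof. by move=> lt_p; rewrite /act /= (drop_nth None lt_p). Qed.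

Lemma act_right (v : seq sym) p : p.+1 < size v ->
  act (M := tr_machine) (rev (take p v), drop p v) (nth None v p, MoveRight) =
  (rev (take p.+1 v), drop p.+1 v).
Proof.
move=> lt_p; rewrite /act (drop_nth None (ltnW lt_p)).
by rewrite (take_nth None (ltnW lt_p)) rev_rcons.
Qed.

Lemma act_left (v : seq sym) p : p.+1 < size v ->
  act (M := tr_machine) (rev (take p.+1 v), drop p.+1 v)
    (nth None v p.+1, MoveLeft) = (rev (take p v), drop p v).
Proof.
move=> lt_p; rewrite /act /= (take_nth None (ltnW lt_p)) rev_rcons.
by rewrite [in RHS](drop_nth None (ltnW lt_p)) (drop_nth None lt_p).
Qed.

Variable w : seq token.
Hypothesis w_neq0 : w <> [::].
Let u := tape_word w.

(** On tape 0 the head stands on the blank just before the output [o]; the listed blanks to its left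
    are what remains of the erased input. *)
Definition rep (ps : seq nat) (o : seq token) (j : 'I_k.+1) : tape tr_machine :=
  if j == ord0 then
    (nseq (size w - size o) None, None :: [seq Some (inl x) | x <- o])
  else let p := nth 0 ps j.-1 in (rev (take p u), drop p u).

Notation tapes := ('I_k.+1 -> tape tr_machine).

Lemma stepE s (T : tapes) : s != ph_halted ->
  step (M := tr_machine) (s, T) =
  let r := [ffun i => scanned (T i)] in
  (tr_next s r, fun i => act (T i) (tr_delta s r i)).
Proof. by rewrite /step /= => /negPf ->. Qed.

Lemma read_rep ps o j : j != ord0 ->
  scanned (rep ps o j) = nth None u (nth 0 ps j.-1).
Proof.
by rewrite /rep => /negPf -> /=; rewrite /scanned /= -nth0 nth_drop addn0.
Qed.

Lemma input_syms_rep ps o : size ps = k ->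
  input_syms [ffun i => scanned (rep ps o i)] = syms u ps.
Proof.
move=> Sk; apply: (@eq_from_nth _ None) => [|i].
  by rewrite [LHS]size_map size_enum_ord size_map.
rewrite [X in i < X]size_map size_enum_ord => lt_i.
rewrite (nth_map (Ordinal lt_i)) ?size_enum_ord // ffunE read_rep //.
by rewrite /= /bump /= nth_enum_ord // (nth_map 0) ?Sk.
Qed.

Lemma nth_u0 p : p < size u -> (nth None u p == lend) = (p == 0).
Proof.
case: p => [|p] //; rewrite size_tape_word !ltnS /= => lt_p.
rewrite (_ : (p.+1 == 0) = false) //; apply/negbTE.
rewrite nth_rcons size_map; case: ltngtP lt_p => // lt_p _.
by rewrite (nth_map TEnd).
Qed.

Lemma nth_u_last p : p < size u -> (nth None u p == rend) = (p == (size w).+1).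
Proof.
case: p => [|p] //; rewrite size_tape_word !ltnS eqSS /= => lt_p.
rewrite nth_rcons size_map; case: ltngtP lt_p => // lt_p _.
by rewrite (nth_map TEnd).
Qed.

Lemma step_run (s : pc c) ps o : size ps = k -> valid u ps ->
  let: (i, n) := exec s (syms u ps) in
  step (M := tr_machine) (inr s, rep ps o) =
    (if n is Some s' then inr s' else ph_finish,
     rep (eff u i (ps, o)).1 (eff u i (ps, o)).2).
Proof.
move=> Sk V; case E: (exec _ _) => [i n]; rewrite stepE //= input_syms_rep // E.
congr pair; apply: functional_extensionality_dep => j.
rewrite ffunE; have [->|j0] := eqVneq j ord0.
  case: i {E} => [|x|h|h] //=; rewrite /rep /= /act //=.
  (* Once the output is as long as the input, the listed blanks are used up and the truncated
     difference stays 0. *)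
  rewrite subnS; case: (size w - size o) => [|m] //=.
have lt_j : j.-1 < size ps.
  by rewrite Sk; case: j j0 => -[].
rewrite read_rep //; have V1 : nth 0 ps j.-1 < size u.
  by apply: (allP V); apply: mem_nth.
have ->: rep ps o j = (rev (take (nth 0 ps j.-1) u), drop (nth 0 ps j.-1) u).
  by rewrite /rep (negPf j0).
have Eh h : (j == h.+1 :> nat) = (j.-1 == h).
  by case: j j0 {lt_j V1} => -[].
case: i {E} => [|x|h|h] /=; rewrite ?/rep ?(negPf j0); try exact: act_stay.
  rewrite nth_upd // Eh nth_u0 //; case: (j.-1 =P h) => _; last exact: act_stay.
  case Ep: (nth 0 ps j.-1) V1 => [|p] V1; first exact: (@act_stay u 0).
  exact: (@act_left u p).
rewrite nth_upd // Eh nth_u_last //; case: (j.-1 =P h) => _; last exact: act_stay.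
rewrite /goR size_tape_word [_.+2.-1]/=; move: (V1).
rewrite size_tape_word ltnS leq_eqVlt.
(* On the right end marker the machine does not move, in agreement with the minimum in [goR]. *)
case: (_ =P (size w).+1) => [Ep _|_ lt_p].
  by rewrite Ep minnE subSnn subn1 -Ep; apply: act_stay.
rewrite (minn_idPl lt_p); apply: act_right.
by rewrite size_tape_word ltnS.
Qed.

Lemma steps_run (s : pc c) m ps o st' : size ps = k -> valid u ps ->
  run u s m (ps, o) st' ->
  iter m (step (M := tr_machine)) (inr s, rep ps o) =
    (ph_finish, rep st'.1 st'.2).
Proof.
elim: m s ps o => [|m IH] s ps o Sk V /runP.
  by case=> [[? []]|[? [? [? []]]]].
case=> [[i [[->] E ->]]|[i [s1 [m1 [[<-] E H]]]]]; rewrite /= in E.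
  by have := step_run s o Sk V; rewrite E.
have := step_run s o Sk V; rewrite E iterSr => ->; apply: IH.
- by rewrite size_eff.
- exact: valid_eff.
- by case: (eff _ _ _) H.
Qed.

(** The copies are one cell ahead of the input because of their left end marker. *)
Definition copy_tapes (i : nat) (j : 'I_k.+1) : tape tr_machine :=
  if j == ord0 then (nseq i None, drop i [seq Some (inl x) | x <- w])
  else (rev (take i.+1 u), [::]).

Lemma steps_copy i : i <= size w ->
  iter i.+1 (step (M := tr_machine)) (init tr_machine w) =
    (ph_copy, copy_tapes i).
Proof.
elim: i => [_|i IH lt_i].
  rewrite /= stepE //; congr pair; apply: functional_extensionality_dep => j.
  rewrite /copy_tapes /= ffunE; case: eqP => _ /=; last by rewrite take0.
  by rewrite /act /scanned /word /= drop0; case: w w_neq0.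
rewrite iterS (IH (ltnW lt_i)) stepE //; set r := finfun _; move=> {IH}.
have Er : r ord0 = Some (inl (nth TEnd w i)).
  by rewrite ffunE /copy_tapes /scanned -nth0 nth_drop addn0 (nth_map TEnd).
rewrite /tr_next /tr_delta /= Er.
congr pair; apply: functional_extensionality_dep => j.
rewrite /copy_tapes; case: eqP => _.
  by rewrite /act (drop_nth None) ?size_map.
rewrite /act [behead _]/=; congr pair.
have lt_u : i.+1 < size u by rewrite size_tape_word !ltnS ltnW.
rewrite (take_nth None lt_u) rev_rcons; congr (_ :: _).
by rewrite /= nth_rcons size_map lt_i (nth_map TEnd).
Qed.

(** The input heads move in lockstep, so testing the first one suffices; the additional step is the
    one that sees the left end marker. *)
Lemma steps_rewind p : 0 < k -> p < size u ->
  iter p.+1 (step (M := tr_machine)) (ph_rewind, rep (nseq k p) [::]) =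
    (inr (entry c), rep (nseq k 0) [::]).
Proof.
move=> k_gt0; have Es q : step (M := tr_machine)
    (ph_rewind, rep (nseq k q) [::]) =
    (if head lend (syms u (nseq k q)) == lend then inr (entry c) else ph_rewind,
     fun j => act (rep (nseq k q) [::] j)
       (tr_delta ph_rewind [ffun i => scanned (rep (nseq k q) [::] i)] j)).
  by rewrite stepE //= input_syms_rep ?size_nseq.
have hd q : head lend (syms u (nseq k q)) = nth None u q.
  by case: k k_gt0.
have nk q (j : 'I_k.+1) : j != ord0 -> nth 0 (nseq k q) j.-1 = q.
  by case: j => -[|j] //= lt_j _; rewrite nth_nseq -ltnS lt_j.
have Ed q : q < size u -> (fun j => act (rep (nseq k q) [::] j)
    (tr_delta ph_rewind [ffun i => scanned (rep (nseq k q) [::] i)] j)) =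
    rep (nseq k q.-1) [::].
  move=> lt_q; apply: functional_extensionality_dep => j.
  rewrite /tr_delta /= ffunE; case: (eqVneq j ord0) => [->|j0] //.
  rewrite read_rep // nk // nth_u0 // /rep (negPf j0) !nk //.
  case: q lt_q => [|q] lt_q; first exact: (@act_stay u 0).
  exact: (@act_left u q).
elim: p => [|p IH] lt_p; first by rewrite /= Es hd eqxx Ed.
rewrite iterSr Es hd nth_u0 // [p.+1 == 0]/= Ed //.
by apply: IH; apply: ltnW.
Qed.

Lemma step_copied :
  step (M := tr_machine) (ph_copy, copy_tapes (size w)) =
    (ph_rewind, rep (nseq k (size w).+1) [::]).
Proof.
rewrite stepE //; set r := finfun _.
have Er : r ord0 = None.
  by rewrite ffunE /copy_tapes /scanned -nth0 nth_drop addn0 nth_default ?size_map.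
rewrite /tr_next /tr_delta /= Er.
congr pair; apply: functional_extensionality_dep => j.
rewrite /copy_tapes /rep; case: (eqVneq j ord0) => [_|j0].
  by rewrite /act drop_oversize ?size_map // subn0.
have -> : nth 0 (nseq k (size w).+1) j.-1 = (size w).+1.
  by case: j j0 => -[|j] //= lt_j _; rewrite nth_nseq -ltnS lt_j.
rewrite /act (drop_nth None) ?size_tape_word // drop_oversize ?size_tape_word //.
by rewrite /= nth_rcons size_map ltnn eqxx.
Qed.

Lemma outputs_runs n ps o : 0 < k ->
  runs u c (nseq k 0, [::]) (ps, o) ->
  2 * size w + 5 + #|pc c| * size u ^ k <= n ->
  outputs_within tr_machine n w o.
Proof.
move=> k_gt0 [m R] le_n.
have V0 : valid u (nseq k 0) by apply/allP => x /nseqP[->].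
have le_m := run_time _ V0 R; rewrite size_nseq in le_m.
pose st := step (M := tr_machine).
(* Copying and rewinding take [(size w).+2] steps each, the run takes [m], and a last step moves the
   head of tape 0 from the blank onto the output. *)
pose N := (m + ((size w).+2 + (size w).+2)).+1.
have EN : iter N st (init tr_machine w) = (ph_halted, fun j => act (rep ps o j)
    (tr_delta ph_finish [ffun i => scanned (rep ps o i)] j)).
  rewrite iterS iterD iterD [iter (size w).+2 st (init _ _)]iterS.
  rewrite /st steps_copy // step_copied steps_rewind ?size_tape_word //.
  by rewrite (steps_run _ V0 R) ?size_nseq // stepE.
have {}le_n : N <= n.
  apply: leq_trans le_n; rewrite /N [m + _]addnC -addSn; apply: leq_add.
    by rewrite mul2n -addnn !addSn !addnS addn0.
  exact: le_m.
have fixed q : iter q st (iter N st (init tr_machine w)) =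
    iter N st (init tr_machine w).
  elim: q => // q IHq; rewrite iterS IHq EN.
  by rewrite /st /step /=.
rewrite /outputs_within -(subnK le_n) iterD fixed EN; split.
  by [].
by move=> i _.
Qed.

End Machine.

Lemma transducer_polytime k (c : prog) (A B : Type) (encA : A -> seq token)
    (encB : B -> seq token) (f : A -> B) :
  0 < k -> (forall x, encA x <> [::]) ->
  (forall x, exists ps,
     runs (tape_word (encA x)) c (nseq k 0, [::]) (ps, encB (f x))) ->
  polytime_computable encA encB f.
Proof.
move=> k_gt0 enc_neq0 R.
exists (tr_machine k c),
  (2%N *: 'X + 5%N%:P + (#|pc c|)%:P * ('X + 2%N%:P) ^+ k)%R => x.
have [ps Rx] := R x; apply: (outputs_runs (enc_neq0 x) k_gt0 Rx).
rewrite !(hornerD, hornerZ, hornerX, hornerC, hornerM, horner_exp).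
apply: eq_leq; rewrite natrXE size_tape_word.
by congr (_ + _ * _ ^ _); rewrite -addn2.
Qed.

(** * The translation *)

(** [Dom a] says that [a] holds on the stored trace of the old model, [Pair a r] that it holds on
    the trace assigned to [r]; [Lev i] is the stored position and [St i h] a truth value on the
    stack. *)
Inductive label : Type :=
| Dom of name
| Pair of name & name
| Lev of nat
| St of nat & nat.

(** Each bit is preceded by a continuation mark, so that the first component of a pair is
    self-delimiting. *)
Definition dbl (b : bool) : name := [:: true; b].

(** Two tag bits tell the constructors apart. Numbers are in unary: names stay polynomially long,
    and a head writes a number by walking to the left end. *)
Definition lname (x : label) : name :=
  match x with
  | Dom a => [:: false, false & a]
  | Pair a r => [:: false, true & flatten [seq dbl b | b <- a] ++ false :: r]
  | Lev i => [:: true, false & nseq i true]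
  | St i h => [:: true, true & nseq i true ++ false :: nseq h true]
  end.

Arguments lname : simpl never.

Lemma lname_inj : injective lname.
Proof.
have inj_dbl a b r s : flatten [seq dbl x | x <- a] ++ false :: r =
    flatten [seq dbl x | x <- b] ++ false :: s -> a = b /\ r = s.
  elim: a b => [|x a IH] [|y b] //=; first by case=> ->.
  by case=> -> /IH[-> ->].
have inj_un i j h l : nseq i true ++ false :: nseq h true =
    nseq j true ++ false :: nseq l true -> i = j /\ h = l.
  elim: i j => [|i IH] [|j] //=.
    by case=> /(congr1 size); rewrite !size_nseq.
  by case=> /IH[-> ->].
case=> [a|a r|i|i h] [b|b s|j|j l]; rewrite /lname //= => -[].
- by move=> ->.
- by case/inj_dbl=> -> ->.
- by move/(congr1 size); rewrite !size_nseq => ->.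
- by case/inj_un=> -> ->.
Qed.

Definition At (x : label) (v : name) : body := Atom (lname x) v.

Definition vp : name := [::].
Definition vq : name := [:: true].
Definition vt : name := [:: false].
Definition vi : name := [:: true; true].

(** The syntax has no constant for truth; an excluded middle on a fixed atom replaces it. *)
Definition Tt : body := Or (Atom [::] vp) (Neg (Atom [::] vp)).
Definition Ff : body := Neg Tt.
Definition And (x y : body) : body := Neg (Or (Neg x) (Neg y)).
Definition Ev (x : body) : body := Until Tt x.
Definition Xor (x y : body) : body := Or (And x (Neg y)) (And (Neg x) y).

Fixpoint take_name (w : seq token) : name :=
  if w is TBit b :: w' then b :: take_name w' else [::].
Fixpoint drop_name (w : seq token) : seq token :=
  match w with
  | TBit _ :: w' => drop_name w'
  | _ :: w' => w'
  | [::] => [::]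
  end.

Lemma take_nameE x w : take_name (encode_name x ++ w) = x.
Proof. by elim: x => //= b x ->. Qed.

Lemma drop_nameE x w : drop_name (encode_name x ++ w) = w.
Proof. by elim: x. Qed.

(* Positions are those of the tape, where the word starts at position 1. *)
Definition sfx (w : seq token) (i : nat) : seq token :=
  if i is j.+1 then drop j w else [::].

(** The tokens of a name get arity 1 and hand the top of the stack on unchanged, so names are passed
    over without parsing. *)
Definition arity (c : token) : nat :=
  match c with TAtom => 0 | TOr | TUntil => 2 | _ => 1 end.

(* Reading a formula in Polish notation from right to left with a stack, St i h
   is the value at depth h once position i has been read. *)
Definition stack_top (i : nat) (c : token) (w : seq token) : body :=
  match c with
  | TAtom => At (Pair (take_name w) (take_name (drop_name w))) vp
  | TNeg => Neg (At (St i.+1 0) vp)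
  | TOr => Or (At (St i.+1 0) vp) (At (St i.+1 1) vp)
  | TNext => Next (At (St i.+1 0) vp)
  | TUntil => Until (At (St i.+1 0) vp) (At (St i.+1 1) vp)
  | _ => At (St i.+1 0) vp
  end.

(** Constraints are stated through their violations, whose disjunction is negated in the matrix. The
    last family says that reading [c] pops [arity c] values and pushes one. *)
Definition stack_viol (n i : nat) (c : token) (w : seq token) : seq body :=
  [:: And (At (Lev i) vp) (Neg (At (St i 0) vp)),
      Ev (Xor (At (St i 0) vp) (stack_top i c w)) &
      [seq Ev (Xor (At (St i h.+1) vp) (At (St i.+1 (h + arity c)) vp))
         | h <- iota 0 n.+1]].

(** Both cases of the comparison are always present, with the constant [e] switching one of them
    off; the program thus has to compare names only in order to write a constant. *)
Definition pair_viol (i : nat) (r pi a rho : name) : seq body :=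
  let e := if pi == rho then Tt else Ff in
  [:: And (At (Lev i) vp)
        (And e (Ev (Xor (At (Pair a rho) vt) (At (Dom a) r))));
      And (At (Lev i) vp)
        (And (Neg e) (Ev (Xor (At (Pair a rho) vt) (At (Pair a rho) vp))))].

(** The offset 2 in the new position accounts for the quantifier token and the end token of its
    variable. The assignment is updated for every atom that occurs in [w]. *)
Definition quant_viol (w : seq token) (i : nat) (r : name) (v : seq token) :
    seq body :=
  And (At (Lev i) vp) (Neg (At (Lev (i + size (take_name v)).+2) vt)) ::
  flatten [seq if sfx w j is TAtom :: v' then
                 pair_viol i r (take_name v) (take_name v')
                   (take_name (drop_name v'))
               else [::] | j <- iota 0 (size w).+1].

Definition viol_at (w : seq token) (i : nat) : seq body :=
  match sfx w i with
  | [::] => [::]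
  | TExists :: v => quant_viol w i vt v
  | TForall :: v => quant_viol w i vq v
  | c :: v => stack_viol (size w) i c v
  end.

Definition viols (w : seq token) : seq body :=
  flatten [seq viol_at w i | i <- iota 0 (size w).+1].

Definition matrix_of (w : seq token) : body :=
  Neg (Or (Neg (At (Lev 1) vi)) (foldr Or Ff (viols w))).

Definition target (w : seq token) : hyperltl :=
  Forall vp (Forall vq (foldr Exists (Body (matrix_of w)) [:: vt; vi])).

(** * Closedness and temporal depth of the target *)

Lemma all_foldr_Or (P : pred body) vs :
  (forall x y, P x -> P y -> P (Or x y)) -> P Ff ->
  all P vs -> P (foldr Or Ff vs).
Proof. by move=> POr PF; elim: vs => //= v vs IH /andP[Pv /IH]; apply: POr. Qed.

Lemma all_flatten T (P : pred T) ss : all P (flatten ss) = all (all P) ss.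
Proof. by elim: ss => //= s ss IH; rewrite all_cat IH. Qed.

Lemma all_viols (P : pred body) w :
  (forall i c v, all P (stack_viol (size w) i c v)) ->
  (forall i r v, r \in [:: vq; vt] -> all P (quant_viol w i r v)) ->
  all P (viols w).
Proof.
move=> Pst Pqu; rewrite all_flatten all_map; apply/allP => i _ /=.
rewrite /viol_at; case: (sfx w i) => [//|[] v] //; first exact: Pqu.
by apply: Pqu; rewrite inE.
Qed.

Lemma target_closed w : Defs.closed [::] (target w).
Proof.
rewrite /= all_foldr_Or //; first by move=> x y /= -> ->.
apply: all_viols => [i c v|i r v r_in].
  by rewrite /= all_map; apply/andP; split; [case: c | apply/allP].
rewrite /= all_flatten all_map; apply/allP => j _ /=.
case: (sfx w j) => [//|[] v'] //=; rewrite /pair_viol /=.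
by case: ifP => _; move: r_in; rewrite !inE => /orP[] /eqP ->.
Qed.

Lemma target_td w : td (target w) <= 2.
Proof.
rewrite /= geq_max /=.
apply: (@all_foldr_Or (fun x => body_td x <= 2)) => //.
  by move=> x y /= lex ley; rewrite geq_max lex.
apply: all_viols => [i c v|i r v _].
  by rewrite /= all_map; apply/andP; split; [case: c | apply/allP].
rewrite /= all_flatten all_map; apply/allP => j _ /=.
by case: (sfx w j) => [//|[] v'] //=; rewrite /pair_viol; case: ifP.
Qed.

Definition target_sentence (phi : sentence) : sentence :=
  Sentence (target_closed (encode phi)).

(* The truth of a formula at position j, when val v j a tells whether
   proposition a holds at position j of the trace assigned to v. *)
Fixpoint bsem (val : name -> nat -> name -> Prop) (j : nat) (psi : body) : Prop :=
  match psi with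
  | Atom a pi => val pi j a
  | Neg psi1 => ~ bsem val j psi1
  | Or psi1 psi2 => bsem val j psi1 \/ bsem val j psi2
  | Next psi1 => bsem val j.+1 psi1
  | Until psi1 psi2 => exists2 k, bsem val (j + k) psi2 &
      forall i, i < k -> bsem val (j + i) psi1
  end.

Definition valuation (Pi : assignment) (v : name) (j : nat) (a : name) : Prop :=
  exists2 t, Pi v = Some t & a \in t j.

Lemma shiftD j k Pi : shift k (shift j Pi) = shift (j + k) Pi.
Proof.
apply/funext => v; rewrite /shift; case: (Pi v) => //= t.
by congr Some; apply/funext => i; rewrite addnA.
Qed.

Lemma body_sat_shift j Pi psi :
  body_sat (shift j Pi) psi <-> bsem (valuation Pi) j psi.
Proof.
elim: psi j => [a v|p IH|p IHp q IHq|p IH|p IHp q IHq] j /=.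
- rewrite /shift /valuation; split=> [[t]|[t -> at_j]].
    by case: (Pi v) => //= t' [<-]; rewrite addn0; exists t'.
  by exists (fun i => t (j + i)); rewrite //= addn0.
- by rewrite IH.
- by rewrite IHp IHq.
- by rewrite shiftD addn1 IH.
- by split=> -[k]; rewrite ?shiftD => /IHq Hq Hp; exists k; rewrite ?shiftD //;
    move=> i /Hp; rewrite ?shiftD => /IHp.
Qed.

Lemma body_satE Pi psi : body_sat Pi psi <-> bsem (valuation Pi) 0 psi.
Proof.
rewrite -body_sat_shift; suff -> : shift 0 Pi = Pi by [].
by apply/funext => v; rewrite /shift; case: (Pi v).
Qed.

Fixpoint body_all (P : name -> name -> Prop) (psi : body) : Prop :=
  match psi with
  | Atom a v => P a v
  | Neg psi1 | Next psi1 => body_all P psi1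
  | Or psi1 psi2 | Until psi1 psi2 => body_all P psi1 /\ body_all P psi2
  end.

Lemma body_allW (P Q : name -> name -> Prop) psi :
  (forall a v, P a v -> Q a v) -> body_all P psi -> body_all Q psi.
Proof.
move=> PQ; elim: psi => [a v|p IH|p IHp q IHq|p IH|p IHp q IHq] //=; first exact: PQ.
- by case=> /IHp ? /IHq.
- by case=> /IHp ? /IHq.
Qed.

Lemma body_allI (P Q : name -> name -> Prop) psi :
  body_all P psi -> body_all Q psi -> body_all (fun a v => P a v /\ Q a v) psi.
Proof.
elim: psi => [a v|p IH|p IHp q IHq|p IH|p IHp q IHq] //=; try exact: IH.
- by case=> /IHp Hp /IHq Hq [/Hp ? /Hq].
- by case=> /IHp Hp /IHq Hq [/Hp ? /Hq].
Qed.

Lemma eq_bsem (val val' : name -> nat -> name -> Prop) psi j :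
  body_all (fun a v => forall k, val v k a <-> val' v k a) psi ->
  bsem val j psi <-> bsem val' j psi.
Proof.
elim: psi j => [a v|p IH|p IHp q IHq|p IH|p IHp q IHq] j /=; first by apply.
- by move=> /IH ->.
- by case=> /IHp -> /IHq ->.
- by move=> /IH ->.
- by case=> Hp Hq; split=> -[k] /(IHq _ Hq) ? Hk; exists k => // i /Hk /(IHp _ Hp).
Qed.

Lemma body_all_props psi : body_all (fun a _ => a \in body_props psi) psi.
Proof.
elim: psi => [a v|p IH|p IHp q IHq|p IH|p IHp q IHq] //=; first by rewrite inE.
- split; [apply: body_allW IHp|apply: body_allW IHq] => a _ a_in;
    by rewrite inE a_in ?orbT.
- split; [apply: body_allW IHp|apply: body_allW IHq] => a _ a_in;
    by rewrite inE a_in ?orbT.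
Qed.

Lemma body_all_closed bound psi :
  body_closed bound psi -> body_all (fun _ v => v \in bound) psi.
Proof.
elim: psi => [a v|p IH|p IHp q IHq|p IH|p IHp q IHq] //=.
- by case/andP=> /IHp ? /IHq.
- by case/andP=> /IHp ? /IHq.
Qed.

(** A fold instead of a quantification over members, as [body] has not been given a decidable
    equality. *)
Definition none (P : body -> Prop) (vs : seq body) : Prop :=
  foldr (fun v Q => ~ P v /\ Q) True vs.

Lemma none_cat P vs vs' : none P (vs ++ vs') <-> none P vs /\ none P vs'.
Proof. by elim: vs => [|v vs IH] /=; [|rewrite IH]; tauto. Qed.

Lemma none_flatten P (I : eqType) (F : I -> seq body) s :
  none P (flatten [seq F i | i <- s]) <-> forall i, i \in s -> none P (F i).
Proof.
elim: s => [|i s IH] //=; rewrite none_cat IH; split=> [[Hi Hs] j|H].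
  by rewrite inE => /predU1P[->|/Hs].
by split=> [|j j_in]; apply: H; rewrite inE ?eqxx ?j_in ?orbT.
Qed.

Lemma none_map P (I : eqType) (F : I -> body) s :
  none P [seq F i | i <- s] <-> forall i, i \in s -> ~ P (F i).
Proof.
elim: s => [|i s IH] //=; rewrite IH; split=> [[Hi Hs] j|H].
  by rewrite inE => /predU1P[->|/Hs].
by split=> [|j j_in]; apply: H; rewrite inE ?eqxx ?j_in ?orbT.
Qed.

(** * Meaning of the constraints *)

Section Semantics.
Variable val : name -> nat -> name -> Prop.

Local Notation holds x v j := (val v j (lname x)).

Lemma bsem_Tt j : bsem val j Tt.
Proof. exact: EM. Qed.

Lemma bsem_And x y j : bsem val j (And x y) <-> bsem val j x /\ bsem val j y.
Proof.
rewrite /=; split=> [H|[Hx Hy] []] //.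
by split; apply: contrapT => Hn; apply: H; [left|right].
Qed.

Lemma bsem_Ev x j : bsem val j (Ev x) <-> exists k, bsem val (j + k) x.
Proof.
split=> [[k Hk _]|[k Hk]]; first by exists k.
by exists k => // i _; apply: bsem_Tt.
Qed.

Lemma bsem_Xor x y j :
  bsem val j (Xor x y) <-> ~ (bsem val j x <-> bsem val j y).
Proof.
change (bsem val j (And x (Neg y)) \/ bsem val j (And (Neg x) y) <->
  ~ (bsem val j x <-> bsem val j y)).
rewrite !bsem_And /=.
by case: (EM (bsem val j x)); case: (EM (bsem val j y)); tauto.
Qed.

Lemma no_Ev_Xor x y :
  ~ bsem val 0 (Ev (Xor x y)) <-> forall j, bsem val j x <-> bsem val j y.
Proof.
rewrite bsem_Ev; split=> [H j|H [j /bsem_Xor]]; last by rewrite add0n.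
by apply: contrapT => Hj; apply: H; exists j; rewrite bsem_Xor.
Qed.

Lemma bsem_foldr_Or vs :
  ~ bsem val 0 (foldr Or Ff vs) <-> none (bsem val 0) vs.
Proof.
elim: vs => [|v vs IH] /=.
  by split=> // _; apply: contrapT; case: (EM (val vp 0 [::])); tauto.
by rewrite -IH; tauto.
Qed.

Lemma bsem_matrix w : bsem val 0 (matrix_of w) <->
  holds (Lev 1) vi 0 /\ forall i, i <= size w -> none (bsem val 0) (viol_at w i).
Proof.
have -> : (forall i, i <= size w -> none (bsem val 0) (viol_at w i)) <->
    none (bsem val 0) (viols w).
  rewrite none_flatten; split=> H i; first by rewrite mem_iota add0n ltnS => /H.
  by move=> lei; apply: H; rewrite mem_iota.
rewrite -bsem_foldr_Or [bsem _ _ _]/=; split=> [H|]; last by tauto.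
by split=> [|H']; [apply: contrapT => H'|]; apply: H; tauto.
Qed.

Lemma none_stack_viol n i c v : none (bsem val 0) (stack_viol n i c v) <->
  (holds (Lev i) vp 0 -> holds (St i 0) vp 0) /\
  (forall j, holds (St i 0) vp j <-> bsem val j (stack_top i c v)) /\
  (forall h j, h <= n ->
     (holds (St i h.+1) vp j <-> holds (St i.+1 (h + arity c)) vp j)).
Proof.
rewrite /stack_viol; set s := (X in _ :: _ :: X).
have -> : forall x y, none (bsem val 0) [:: x, y & s] <->
  ~ bsem val 0 x /\ ~ bsem val 0 y /\ none (bsem val 0) s by [].
rewrite none_map no_Ev_Xor bsem_And.
split=> -[H1 [H2 H3]]; split; [|split=> //| |split=> //].
- by move=> Hi; apply: contrapT => ?; apply: H1.
- move=> h j leh; have /H3 : h \in iota 0 n.+1 by rewrite mem_iota.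
  by rewrite no_Ev_Xor; apply.
- by case=> /H1 Hi; apply.
- move=> h; rewrite mem_iota ltnS => leh; rewrite no_Ev_Xor => j; exact: H3.
Qed.

Lemma none_pair_viol i r pi a rho : none (bsem val 0) (pair_viol i r pi a rho) <->
  (holds (Lev i) vp 0 -> forall k, holds (Pair a rho) vt k <->
     if pi == rho then holds (Dom a) r k else holds (Pair a rho) vp k).
Proof.
rewrite /pair_viol; set e := if _ then _ else _.
have -> : forall x y, none (bsem val 0) [:: x; y] <->
  ~ bsem val 0 x /\ ~ bsem val 0 y.
  by move=> x y /=; tauto.
rewrite !bsem_And.
have Ee : bsem val 0 e <-> pi == rho.
  rewrite /e; case: (pi == rho); split=> // H; first exact: bsem_Tt.
  by case: H; apply: bsem_Tt.
have -> : bsem val 0 (Neg e) <-> ~ (pi == rho) by rewrite -Ee.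
rewrite Ee; case: (pi == rho).
  have [X1 X2] := no_Ev_Xor (At (Pair a rho) vt) (At (Dom a) r).
  split=> [[H1 _] Hl|H]; first by apply: X1 => ?; apply: H1.
  by split=> [[Hl [_]]|[_ []]] //; apply: X2 (H Hl).
have [X1 X2] := no_Ev_Xor (At (Pair a rho) vt) (At (Pair a rho) vp).
split=> [[_ H1] Hl|H]; first by apply: X1 => ?; apply: H1.
by split=> [[_ []]|[Hl [_]]] //; apply: X2 (H Hl).
Qed.

Lemma none_quant_viol w i r v : none (bsem val 0) (quant_viol w i r v) <->
  (holds (Lev i) vp 0 ->
   holds (Lev (i + size (take_name v)).+2) vt 0 /\
   forall j v', j < size w -> drop j w = TAtom :: v' ->
     let a := take_name v' in let rho := take_name (drop_name v') in
     forall k, holds (Pair a rho) vt k <->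
       if take_name v == rho then holds (Dom a) r k else holds (Pair a rho) vp k).
Proof.
rewrite /quant_viol; set s := flatten _.
have -> : forall x, none (bsem val 0) (x :: s) <->
  ~ bsem val 0 x /\ none (bsem val 0) s by [].
rewrite bsem_And none_flatten; split=> [[H1 H2] Hi|H].
  split; first by apply: contrapT => ?; apply: H1.
  move=> j v' ltj Ej /=; have := H2 j.+1; rewrite mem_iota /= Ej.
  by rewrite none_pair_viol => /(_ ltj Hi).
split=> [[/H[Hl _]]|j]; first by [].
rewrite mem_iota; case: j => [|j] //= ltj.
case Ej: (drop j w) => [//|[] v'] //; apply/none_pair_viol => /H[_ H'].
exact: H' Ej.
Qed.

End Semantics.

(** * Evaluation of Polish notation with a stack *)

Section Stack.
Variables (base : nat -> nat -> Prop) (alpha : name -> name -> nat -> Prop).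

(* The stack, as a function of depth and position in time, after w has been
   read from right to left on top of the stack base. *)
Fixpoint stack (w : seq token) (h j : nat) : Prop :=
  match w with
  | [::] => base h j
  | c :: w' =>
      match h with
      | h'.+1 => stack w' (h' + arity c) j
      | 0 =>
          match c with
          | TAtom => alpha (take_name w') (take_name (drop_name w')) j
          | TNeg => ~ stack w' 0 j
          | TOr => stack w' 0 j \/ stack w' 1 j
          | TNext => stack w' 0 j.+1
          | TUntil => exists2 k, stack w' 1 (j + k) &
              forall i, i < k -> stack w' 0 (j + i)
          | _ => stack w' 0 j
          end
      end
  end.

Lemma stack_name x w : stack (encode_name x ++ w) = stack w.
Proof.
by elim: x => [|b x IH] /=; apply/funext => -[|h]; apply/funext => j;
  rewrite /= ?addn1 ?IH.
Qed.

(** Reading a whole body pushes its value and leaves the rest alone. Both halves go through one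
    induction: the value of a second operand lies at depth 1, under that of the first. *)
Lemma stack_body psi w :
  (forall j, stack (encode_body psi ++ w) 0 j <->
     bsem (fun v j a => alpha a v j) j psi) /\
  (forall h, stack (encode_body psi ++ w) h.+1 = stack w h).
Proof.
elim: psi w => [a v|p IH|p IHp q IHq|p IH|p IHp q IHq] w; split=> [j|h];
  rewrite /= -?catA.
- by rewrite take_nameE drop_nameE take_nameE.
- by apply/funext => j; rewrite !stack_name addn0.
- by rewrite (IH w).1.
- by rewrite addn1 (IH w).2.
- by rewrite (IHp _).1 (IHp _).2 (IHq w).1.
- by rewrite addn2 (IHp _).2 (IHq w).2.
- by rewrite (IH w).1.
- by rewrite addn1 (IH w).2.
- rewrite (IHp _).2; split=> -[k Hq Hp]; exists k; try exact/(IHq w).1;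
    by move=> i /Hp; rewrite (IHp _).1.
- by rewrite addn2 (IHp _).2 (IHq w).2.
Qed.

End Stack.

Definition is_quant (c : token) : bool :=
  match c with TExists | TForall => true | _ => false end.

Lemma quantless_name x w :
  all (predC is_quant) (encode_name x ++ w) = all (predC is_quant) w.
Proof. by elim: x => //= b x ->. Qed.

Lemma quantless_body psi w :
  all (predC is_quant) (encode_body psi ++ w) = all (predC is_quant) w.
Proof.
elim: psi w => [a v|p IH|p IHp q IHq|p IH|p IHp q IHq] w //=;
  by rewrite -?catA ?quantless_name ?IHp ?IHq ?IH.
Qed.

Section StackSound.
Variables (val : name -> nat -> name -> Prop) (w : seq token).
Hypothesis ok : forall i, i <= size w -> none (bsem val 0) (viol_at w i).

Let S h i j := val vp j (lname (St i h)).

(* Only the depths below the position are determined by the constraints, and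
   no others are used. *)
Lemma stack_sound v i h j : drop i w = v -> all (predC is_quant) v ->
  i + size v = size w -> h <= i ->
  S h i.+1 j <-> stack (fun h j => S h (size w).+1 j)
    (fun a rho j => val vp j (lname (Pair a rho))) v h j.
Proof.
elim: v i h j => [|c v IH] i h j Ev; first by rewrite /= addn0 => _ ->.
rewrite /= => /andP[qc qv] sz leh.
have lti : i < size w by rewrite -sz addnS ltnS leq_addr.
have Ev1 : drop i.+1 w = v by rewrite -add1n -drop_drop Ev /= drop0.
have Hv h' j' : h' <= i.+1 -> val vp j' (lname (St i.+2 h')) <-> _ :=
  IH i.+1 h' j' Ev1 qv (etrans (addSnnS _ _) sz).
have : none (bsem val 0) (stack_viol (size w) i.+1 c v).
  by have := ok lti; rewrite /viol_at /= Ev; case: (c) qc.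
rewrite none_stack_viol => -[_ [top below]].
case: h leh => [|h] leh.
  rewrite /S top; case: c {Ev qc sz below top} => [||||||| b|] //=;
    rewrite ?Hv //.
  by split=> -[k Hk1 Hk0]; exists k => [|l /Hk0 Hl]; apply/Hv.
(* One value is pushed and at most two are popped, so depth [h.+1] refers to depth at most [h + 2]
   at the next position and the bound by the position persists. *)
rewrite /S below ?(leq_trans (ltnW leh)) // 1?ltnW //.
apply: Hv; apply: leq_trans (_ : h + 2 <= _); last by rewrite addn2.
by rewrite leq_add2l; case: (c).
Qed.

End StackSound.

(** * From a model of the target to a model of the formula *)

Definition occurs (w : seq token) (a rho : name) : Prop :=
  exists l r, w = l ++ TAtom :: encode_name a ++ encode_name rho ++ r.

Lemma body_all_occurs w l psi r :
  w = l ++ encode_body psi ++ r -> body_all (occurs w) psi.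
Proof.
elim: psi l r => [a v|p IH|p IHp q IHq|p IH|p IHp q IHq] l r /= Ew.
- by exists l, r; rewrite Ew -catA.
- by apply: (IH (rcons l TNeg) r); rewrite cat_rcons.
- split; first by apply: (IHp (rcons l TOr) (encode_body q ++ r));
    rewrite cat_rcons catA.
  by apply: (IHq (rcons l TOr ++ encode_body p) r); rewrite Ew -catA cat_rcons -catA.
- by apply: (IH (rcons l TNext) r); rewrite cat_rcons.
- split; first by apply: (IHp (rcons l TUntil) (encode_body q ++ r));
    rewrite cat_rcons catA.
  by apply: (IHq (rcons l TUntil ++ encode_body p) r); rewrite Ew -catA cat_rcons -catA.
Qed.

Definition assign4 (p q t i : trace) : assignment :=
  update (update (update (update empty_assignment vp p) vq q) vt t) vi i.

Lemma valuation4 p q t i j a :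
  [/\ valuation (assign4 p q t i) vp j a <-> a \in p j,
      valuation (assign4 p q t i) vq j a <-> a \in q j,
      valuation (assign4 p q t i) vt j a <-> a \in t j &
      valuation (assign4 p q t i) vi j a <-> a \in i j].
Proof.
by split; rewrite /valuation /assign4 /update /=; split=> [[? [<-]]|] //;
  [exists p|exists q|exists t|exists i].
Qed.

Lemma drop_quant w i c x v : drop i w = c :: encode_name x ++ v ->
  i + size (c :: encode_name x ++ v) = size w ->
  drop (i + size x).+2 w = v /\ (i + size x).+2 + size v = size w.
Proof.
move=> Ev <-; split.
  rewrite -!addnS addnC -drop_drop Ev /= drop_size_cat //.
  by rewrite /encode_name size_rcons size_map.
by rewrite /= size_cat /encode_name size_rcons size_map !addSn !addnS addnA.
Qed.

Section Soundness.
Variables (AP : {fset name}) (T' : trace -> Prop) (w : seq token).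

Definition domain_trace (p : trace) : trace :=
  fun j => [fset a in AP | lname (Dom a) \in p j]%fset.
Definition domain (t : trace) : Prop := exists2 p, T' p & t = domain_trace p.

(** Agreement is asked only for atoms that occur in [w], which alone are constrained, and for
    propositions in [AP], to which [domain_trace] cuts down. *)
Definition represents (p : trace) (A : assignment) : Prop :=
  forall a rho t, a \in AP -> occurs w a rho -> A rho = Some t ->
  forall j, a \in t j <-> lname (Pair a rho) \in p j.

Hypothesis T'_ok : forall p, T' p -> forall q, T' q -> exists2 t, T' t &
  exists2 i, T' i & bsem (valuation (assign4 p q t i)) 0 (matrix_of w).

(** One quantifier step, for both quantifiers at once: [r] is the variable whose stored trace is
    assigned, and [s] is its value, [t] or [q]. *)
Lemma represents_update p q s t i l r v A pi :
  let val := valuation (assign4 p q t i) in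
  none (bsem val 0) (quant_viol w l r v) -> take_name v = pi ->
  (forall j a, val r j a <-> a \in s j) ->
  lname (Lev l) \in p 0 -> represents p A ->
  represents t (update A pi (domain_trace s)) /\
  lname (Lev (l + size pi).+2) \in t 0.
Proof.
move=> val /none_quant_viol Hq Epi val_s Lp rep_p.
have Vp j a : val vp j a <-> a \in p j by case: (valuation4 p q t i j a).
have Vt j a : val vt j a <-> a \in t j by case: (valuation4 p q t i j a).
case: Hq => [|/Vt Lt Pt]; first exact/Vp.
rewrite Epi in Lt Pt; split=> // a rho t1 a_in [x [y Ew]] Et1 j.
have Dx : drop (size x) w = TAtom :: encode_name a ++ encode_name rho ++ y.
  by rewrite Ew drop_size_cat.
have lt_x : size x < size w by rewrite Ew size_cat /= addnS ltnS leq_addr.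
have := Pt _ _ lt_x Dx j; rewrite /= take_nameE drop_nameE take_nameE.
rewrite Vt => ->; move: Et1; rewrite /update eq_sym; case: eqP => _.
  by case=> <-; rewrite val_s !inE /= a_in.
by move=> EA; rewrite Vp (rep_p a rho t1) //; exists x, y.
Qed.

(** By induction on [phi], a trace of [T'] that stores the position of [phi] and represents [A]
    witnesses that [A] satisfies [phi]. *)
Lemma target_sound_at phi i (A : assignment) p bound : T' p ->
  drop i w = encode phi -> i + size (encode phi) = size w ->
  lname (Lev i.+1) \in p 0 -> Defs.closed bound phi ->
  (forall rho, rho \in bound -> A rho) -> (props phi `<=` AP)%fset ->
  represents p A -> sat domain A phi.
Proof.
elim: phi i A p bound => [pi phi IH|pi phi IH|psi] i A p bound Tp Ew sz Lp cl
  bnd /= sub rep_p.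
(* An existential step does not consult the second trace, so [p] is taken again; the witness is the
   trace stored in [t]. *)
- have [t Tt [i' Ti' /bsem_matrix[_ ok]]] := T'_ok Tp Tp.
  have lti : i.+1 <= size w by rewrite -sz /= addnS ltnS leq_addr.
  have := ok _ lti; rewrite /viol_at /= Ew /= => Hq.
  have [|rep_t Lt] := represents_update Hq (take_nameE _ _) (s := t) _ Lp rep_p.
    by move=> j a; case: (valuation4 p p t i' j a).
  have [Ew' sz'] := drop_quant Ew sz.
  exists (domain_trace t); first by exists t.
  apply: (IH _ _ _ _ Tt Ew' sz' Lt cl _ sub rep_t) => rho; rewrite inE /update.
  by case: eqP => //= _; apply: bnd.
- move=> t [q Tq ->].
  (* Every element of the domain is stored in some [q], which is the choice for the second universal
     variable. *)
  have [t' Tt [i' Ti' /bsem_matrix[_ ok]]] := T'_ok Tp Tq.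
  have lti : i.+1 <= size w by rewrite -sz /= addnS ltnS leq_addr.
  have := ok _ lti; rewrite /viol_at /= Ew /= => Hq.
  have [|rep_t Lt] := represents_update Hq (take_nameE _ _) (s := q) _ Lp rep_p.
    by move=> j a; case: (valuation4 p q t' i' j a).
  have [Ew' sz'] := drop_quant Ew sz.
  apply: (IH _ _ _ _ Tt Ew' sz' Lt cl _ sub rep_t) => rho; rewrite inE /update.
  by case: eqP => //= _; apply: bnd.
have [t Tt [i' Ti' /bsem_matrix[_ ok]]] := T'_ok Tp Tp.
have lti : i < size w.
  by rewrite -sz /=; case: (psi) => *; rewrite /= addnS ltnS leq_addr.
have Vp j a : valuation (assign4 p p t i') vp j a <-> a \in p j.
  by case: (valuation4 p p t i' j a).
have qpsi : all (predC is_quant) (encode_body psi).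
  by rewrite -[encode_body psi]cats0 quantless_body.
(* A body begins with no quantifier token, so its position carries a stack constraint, which turns
   the stored position into truth of the top value. *)
have St0 : lname (St i.+1 0) \in p 0.
  have : exists c v, drop i w = c :: v /\ ~~ is_quant c.
    rewrite Ew /=; case E: (encode_body psi) qpsi => [|c v] /=; first by case: (psi) E.
    by case/andP=> qc _; exists c, v.
  move=> [c [v [Ev qc]]]; apply/Vp.
  have : none (bsem (valuation (assign4 p p t i')) 0) (stack_viol (size w) i.+1 c v).
    by have := ok _ lti; rewrite /viol_at /= Ev; case: (c) qc.
  by rewrite none_stack_viol => -[+ _]; apply; apply/Vp.
move/Vp/(@stack_sound _ _ ok _ i 0 0 Ew qpsi sz (leq0n i)) : St0.
(* The top value after a complete body does not depend on the unconstrained stack underneath. *)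
rewrite [encode _]/= -[encode_body psi]cats0 (stack_body _ _ _ _).1 body_satE.
apply: (eq_bsem _ _).1.
have Hocc : body_all (occurs w) psi.
  apply: (@body_all_occurs _ (take i w) _ [::]).
  by rewrite cats0 -[encode_body _]/(encode (Body psi)) -Ew cat_take_drop.
have := body_allI (body_allI Hocc (body_all_props psi)) (body_all_closed cl).
apply: body_allW => a rho [[occ a_in] rho_in] j; rewrite Vp.
move: (bnd rho rho_in); rewrite /valuation; case EA: (A rho) => [t0|//] _.
rewrite -(rep_p a rho t0 (fsubsetP sub a a_in) occ EA).
by split=> [|[? [<-]]] //; exists t0.
Qed.

End Soundness.

Lemma target_sound (phi : sentence) AP AP' : (props phi `<=` AP)%fset ->
  satisfiable AP' (target_sentence phi) -> satisfiable AP phi.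
Proof.
move=> sub [T' [[p Tp] _ T'_sat]].
have T'_ok p1 : T' p1 -> forall q, T' q -> exists2 t, T' t &
    exists2 i, T' i & bsem (valuation (assign4 p1 q t i)) 0 (matrix_of (encode phi)).
  move=> Tp1 q Tq; have [t Tt [i Ti sat_i]] := T'_sat _ Tp1 _ Tq.
  by exists t => //; exists i => //; apply/body_satE.
exists (domain AP T'); split.
- by exists (domain_trace AP p), p.
- by move=> t [q _ ->] j; apply/fsubsetP => a; rewrite inE => /andP[].
(* The induction starts from the trace [i], which stores position 1; it represents the empty
   assignment vacuously. *)
have [t _ [i Ti /bsem_matrix[L1 _]]] := T'_ok p Tp p Tp.
apply: (target_sound_at T'_ok Ti (drop0 _) (add0n _) _ (sentence_closed phi)) => //.
by case: (valuation4 p p t i 0 (lname (Lev 1))) => _ _ _ [+ _]; apply.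
Qed.

(** * From a model of the formula to a model of the target *)

Section Completeness.
Variables (T : trace -> Prop) (w : seq token) (AP' : {fset name}).

(* A trace of the model: an element of T, an assignment and the position of
   the subformula which this assignment satisfies. *)
Definition scene : Type := (trace * assignment * nat)%type.

(** A scene counts tokens dropped from [w], one less than the tape position in [Lev]. [St] starts
    from a stack of falsehoods, which complete bodies never consult. *)
Definition label_holds (s : scene) (j : nat) (x : label) : Prop :=
  match x with
  | Dom a => a \in s.1.1 j
  | Pair a rho => valuation s.1.2 rho j a
  | Lev i => i = s.2.+1
  | St i h => stack (fun _ _ => False)
      (fun a rho j => valuation s.1.2 rho j a) (sfx w i) h j
  end.

Definition name_holds (s : scene) (j : nat) (a : name) : Prop :=
  exists2 x, a = lname x & label_holds s j x.

Lemma name_holdsE s j x : name_holds s j (lname x) <-> label_holds s j x.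
Proof. by split=> [[y /lname_inj <-]|] //; exists x. Qed.

Definition scene_trace (s : scene) : trace :=
  fun j => [fset a in AP' | `[< name_holds s j a >]]%fset.

Definition good (s : scene) : Prop :=
  T s.1.1 /\ exists phi, drop s.2 w = encode phi /\ sat T s.1.2 phi.

Definition good_trace (p : trace) : Prop :=
  exists2 s, good s & p = scene_trace s.

(** The successor scene moves past the quantifier of [p], with the witness for an existential one
    and the trace of [q] for a universal one. *)
Lemma good_succ p q : good p -> good q -> exists2 t, good t &
  forall c v pi, drop p.2 w = c :: v -> is_quant c -> take_name v = pi ->
  t.2 = (p.2 + size pi).+2 /\
  t.1.2 = update p.1.2 pi (if c is TExists then t.1.1 else q.1.1).
Proof.
move=> [Tp [phi [Ep sat_p]]] [Tq _].
have E c x psi : drop p.2 w = c :: encode_name x ++ encode psi ->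
    drop (p.2 + size x).+2 w = encode psi.
  move=> Ev; rewrite -!addnS addnC -drop_drop Ev /= drop_size_cat //.
  by rewrite /encode_name size_rcons size_map.
case: phi Ep sat_p => [x phi|x phi|psi] Ep /=.
- case=> t Tt sat_t; exists (t, update p.1.2 x t, (p.2 + size x).+2).
    by split=> //; exists phi; rewrite (E _ _ _ Ep).
  by rewrite Ep => c v pi [<- <-] _ <-; rewrite take_nameE.
- move=> /(_ _ Tq) sat_t; exists (q.1.1, update p.1.2 x q.1.1, (p.2 + size x).+2).
    by split=> //; exists phi; rewrite (E _ _ _ Ep).
  by rewrite Ep => c v pi [<- <-] _ <-; rewrite take_nameE.
(* At a body nothing is demanded of the successor, so [p] is its own. *)
move=> sat_p; exists p; first by split=> //; exists (Body psi).
move=> c v pi Ev qc; have := quantless_body psi [::].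
by rewrite cats0 -[encode_body _]/(encode (Body psi)) -Ep Ev /= qc.
Qed.

(** The matrix is checked for the full valuation of the scenes, before traces are cut down to
    [AP']. *)
Lemma good_matrix p q t i : good p -> i.2 = 0 ->
  (forall c v pi, drop p.2 w = c :: v -> is_quant c -> take_name v = pi ->
    t.2 = (p.2 + size pi).+2 /\
    t.1.2 = update p.1.2 pi (if c is TExists then t.1.1 else q.1.1)) ->
  bsem (fun v => name_holds
    (if v == vp then p else if v == vq then q else if v == vt then t else i))
    0 (matrix_of w).
Proof.
move=> [Tp [phi [Ep sat_p]]] i0 succ; set val := (X in bsem X).
have Vp j x : val vp j (lname x) <-> label_holds p j x by apply: name_holdsE.
have Vq j x : val vq j (lname x) <-> label_holds q j x by apply: name_holdsE.
have Vt j x : val vt j (lname x) <-> label_holds t j x by apply: name_holdsE.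
rewrite bsem_matrix; split; first by apply/name_holdsE; rewrite /= i0.
case=> [|l] le_l; first by [].
rewrite /viol_at [sfx _ _]/=; case Ev: (drop l w) => [|c v] //.
have quant r : is_quant c -> r = (if c is TExists then vt else vq) ->
    none (bsem val 0) (quant_viol w l.+1 r v).
  move=> qc Er; rewrite none_quant_viol Vp /= => -[El].
  (* The guard [Lev] identifies this position with that of [p], so [succ] applies to the token found
     here. *)
  have [Et EA] := succ c v _ (etrans (congr1 (drop^~ w) (esym El)) Ev) qc erefl.
  rewrite Vt /= Et El; split=> // j v' _ Ej k; rewrite Vt /= EA /valuation /update.
  rewrite eq_sym; case: eqP => _; last by rewrite Vp.
  have -> : val r k (lname (Dom (take_name v'))) <->
      take_name v' \in (if c is TExists then t.1.1 else q.1.1) k.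
    by rewrite Er; case: (c) qc.
  by split=> [[? [<-]]|] //; exists (if c is TExists then t.1.1 else q.1.1).
have Ev1 : drop l.+1 w = v by rewrite -add1n -drop_drop Ev /= drop0.
have other : ~~ is_quant c -> none (bsem val 0) (stack_viol (size w) l.+1 c v).
  move=> qc; rewrite none_stack_viol; split; [|split].
  - rewrite !Vp /= => -[El]; rewrite El Ep.
    (* Without a quantifier token here, the formula of the scene is its body, whose truth is the top
       of the stack. *)
    case: phi Ep sat_p => [x phi|x phi|psi] Ep /=.
    + by move: Ev qc; rewrite El Ep => -[<- _].
    + by move: Ev qc; rewrite El Ep => -[<- _].
    by rewrite body_satE -[encode_body psi]cats0 (stack_body _ _ _ _).1.
  - move=> j; rewrite Vp /= Ev.
    by case: c Ev qc {quant} => //= *; rewrite ?Vp /= ?Ev1 //;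
      split=> -[k H1 H0]; exists k => [|m /H0]; rewrite ?Vp /= ?Ev1 //;
      move: H1; rewrite ?Vp /= ?Ev1.
  - by move=> h j _; rewrite !Vp /= Ev Ev1.
by case: c Ev quant other => *; auto.
Qed.

End Completeness.

Lemma target_complete (phi : sentence) AP AP' :
  (props (target_sentence phi) `<=` AP')%fset ->
  satisfiable AP phi -> satisfiable AP' (target_sentence phi).
Proof.
move=> sub [T [[t0 Tt0] _ T_sat]]; set w := encode phi.
exists (good_trace T w AP'); split.
- exists (scene_trace w AP' (t0, empty_assignment, 0)).
  exists (t0, empty_assignment, 0) => //; split=> //.
  by exists phi; rewrite drop0.
- by move=> t [s _ ->] j; apply/fsubsetP => a; rewrite inE => /andP[].
have good_i : good T w (t0, empty_assignment, 0).
  by split=> //; exists phi; rewrite drop0.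
move=> _ [p good_p ->] _ [q good_q ->].
have [t good_t succ] := good_succ good_p good_q.
exists (scene_trace w AP' t); first by exists t.
exists (scene_trace w AP' (t0, empty_assignment, 0)).
  by exists (t0, empty_assignment, 0).
change (body_sat (assign4 (scene_trace w AP' p) (scene_trace w AP' q)
  (scene_trace w AP' t) (scene_trace w AP' (t0, empty_assignment, 0))) (matrix_of w)).
(* All propositions of the matrix lie in [AP'], so cutting the traces down to [AP'] does not affect
   its truth. *)
rewrite body_satE; apply: (eq_bsem _ _).2; last first.
  exact: (good_matrix good_p (erefl : (t0, empty_assignment, 0).2 = 0) succ).
have := body_allI (body_all_props (matrix_of w)) (body_all_closed (target_closed w)).
apply: body_allW => a v [/(fsubsetP sub) a_in v_in] j.
set p' := scene_trace w AP' p; set q' := scene_trace w AP' q.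
set t' := scene_trace w AP' t; set i' := scene_trace w AP' _.
have E s : a \in scene_trace w AP' s j <-> name_holds w s j a.
  by rewrite !inE /= a_in; split=> [/asboolP|/asboolP].
case: (valuation4 p' q' t' i' j a) => Vp Vq Vt Vi.
move: v_in; rewrite !inE => /or4P[] /eqP ->.
- by rewrite Vi E.
- by rewrite Vt E.
- by rewrite Vq E.
- by rewrite Vp E.
Qed.

(** * The program *)

Definition Cat (a b : prog) : prog := Seq b a.
Definition Put (x : token) : prog := Do (Out x).
Definition Puts (s : seq token) : prog := foldr (fun x => Cat (Put x)) (Do Nop) s.

(* On the way out only c2, at the far end, and on the way back c1 at each
   position passed. *)
Definition Loop (tF tB : seq sym -> bool) (fwd back c1 c2 : prog) : prog :=
  Seq (While tF fwd) (Seq c2 (While tB (Seq back c1))).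

Section Emits.
Variable u : seq sym.

Lemma runs_goR h ps o : runs u (Do (GoR h)) (ps, o) (upd (goR u) ps h, o).
Proof. exact: runs_do. Qed.

Lemma runs_goL h ps o : runs u (Do (GoL h)) (ps, o) (upd goL ps h, o).
Proof. exact: runs_do. Qed.

(* The output is written from right to left, so that what is run first comes
   last. *)
Definition emits (c : prog) (ps : seq nat) (s : seq token) : Prop :=
  forall o, runs u c (ps, o) (ps, s ++ o).

Lemma emits_skip ps : emits (Do Nop) ps [::].
Proof. by move=> o; apply: runs_do. Qed.

Lemma emits_cat a b ps s1 s2 :
  emits a ps s1 -> emits b ps s2 -> emits (Cat a b) ps (s1 ++ s2).
Proof. by move=> Ha Hb o; rewrite -catA; apply: runs_seq (Hb _) (Ha _). Qed.

Lemma emits_put x ps : emits (Put x) ps [:: x].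
Proof. by move=> o; apply: runs_do. Qed.

Lemma emits_puts s ps : emits (Puts s) ps s.
Proof.
elim: s => [|x s IH]; first exact: emits_skip.
exact: emits_cat (emits_put _ _) IH.
Qed.

Lemma emits_if t a b ps s :
  emits (if t (syms u ps) then a else b) ps s -> emits (If t a b) ps s.
Proof. by move=> H o; apply: runs_if; apply: H. Qed.

Lemma emits_loop (P : nat -> seq nat) m tF tB fwd back c1 c2 W W' :
  (forall i, i <= m -> tF (syms u (P i)) = (i < m)) ->
  (forall i, i <= m -> tB (syms u (P i)) = (0 < i)) ->
  (forall i o, i < m -> runs u fwd (P i, o) (P i.+1, o)) ->
  (forall i o, i < m -> runs u back (P i.+1, o) (P i, o)) ->
  (forall i, i < m -> emits c1 (P i) (W i)) -> emits c2 (P m) W' ->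
  emits (Loop tF tB fwd back c1 c2) (P 0) (flatten [seq W i | i <- iota 0 m] ++ W').
Proof.
move=> HtF HtB Hf Hb H1 H2 o.
have go d : d <= m -> runs u (While tF fwd) (P (m - d), o) (P m, o).
  elim: d => [|d IH] led; first by rewrite subn0; apply: runs_while0; rewrite HtF ?ltnn.
  have lt_m : m - d.+1 < m by rewrite ltn_subrL (leq_trans _ led).
  apply: runs_while1 (IH (ltnW led)); first by rewrite HtF // ltnW.
  by rewrite -(subnSK led); apply: Hf.
have come d : d <= m -> forall o',
    runs u (While tB (Seq back c1)) (P d, o')
      (P 0, flatten [seq W i | i <- iota 0 d] ++ o').
  elim: d => [|d IH] led o'; first by apply: runs_while0; rewrite HtB.
  rewrite -addn1 iotaD map_cat flatten_cat /= cats0 addn1 -catA.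
  apply: runs_while1 (IH (ltnW led) _); first by rewrite HtB.
  by apply: runs_seq (Hb _ _ led) _; apply: H1.
apply: runs_seq (_ : runs u _ _ (P m, o)) _.
  by have := go m (leqnn _); rewrite subnn.
by apply: runs_seq (H2 _) _; rewrite -catA; apply: come.
Qed.

End Emits.

(* Heads: X on the position treated, Y on a second position or a depth, and
   two scratch heads which count the steps of a walk. *)
Notation headX := false (only parsing).
Notation headY := true (only parsing).

(** * Walks over positions, numbers and names *)

Definition sym_at (h : nat) (r : seq sym) : sym := nth None r h.
Definition is_bit (c : sym) : bool :=
  if c is Some (inl (TBit _)) then true else false.
Definition is_end (c : sym) : bool :=
  if c is Some (inl TEnd) then true else false.

Definition Right (h : bool) (c : prog) : prog :=
  Seq (Do (GoR h)) (Seq c (Do (GoL h))).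

(** The left end marker counts as position 0 and the right one is excluded. For head Y the positions
    also serve as stack depths. *)
Definition Each (h : bool) (c : prog) : prog :=
  Loop (fun r => sym_at h r != rend) (fun r => sym_at h r != lend)
    (Do (GoR h)) (Do (GoL h)) c (Do Nop).

(** The head walks to the left end while scratch head 3 counts the steps, so that the way back
    restores its position. *)
Definition Unary (h : bool) : prog :=
  Loop (fun r => sym_at h r != lend) (fun r => sym_at 3 r != lend)
    (Seq (Do (GoL h)) (Do (GoR 3))) (Seq (Do (GoL 3)) (Do (GoR h)))
    (Put (TBit true)) (Do Nop).

(** The program [c] runs at the end of the name, so walks can be chained by nesting; [s] selects the
    scratch head, to keep nested walks apart. *)
Definition NameWalk (h s : bool) (f : bool -> seq token) (c : prog) : prog :=
  Loop (fun r => is_bit (sym_at h r)) (fun r => sym_at (2 + s) r != lend)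
    (Seq (Do (GoR h)) (Do (GoR (2 + s)))) (Seq (Do (GoL (2 + s))) (Do (GoL h)))
    (If (fun r => if sym_at h r is Some (inl (TBit true)) then true else false)
       (Puts (f true)) (Puts (f false))) c.

Definition Compare (a b : prog) : prog :=
  Loop (fun r => is_bit (sym_at 0 r) && (sym_at 0 r == sym_at 1 r))
    (fun r => sym_at 3 r != lend)
    (Seq (Do (GoR 0)) (Seq (Do (GoR 1)) (Do (GoR 3))))
    (Seq (Do (GoL 3)) (Seq (Do (GoL 1)) (Do (GoL 0))))
    (Do Nop)
    (If (fun r => is_end (sym_at 0 r) && is_end (sym_at 1 r))
       a b).

Section Walks.
Variable w : seq token.
Let u := tape_word w.

(** The length equation keeps [p] on the tape even when [s] is empty. *)
Definition sits (p : nat) (s : seq token) : Prop :=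
  [/\ 0 < p, sfx w p = s & p + size s = (size w).+1].

Lemma sits_cat p s1 s2 : sits p (s1 ++ s2) -> sits (p + size s1) s2.
Proof.
case: p => [|p] [] //= _ Es sz; split=> //; last by rewrite -sz size_cat addnA.
by rewrite addSn /= addnC -drop_drop Es drop_size_cat.
Qed.

Lemma sits_cons p c s : sits p (c :: s) -> sits p.+1 s.
Proof. by rewrite -cat1s => /sits_cat; rewrite addn1. Qed.

Lemma sits_nth p c s : sits p (c :: s) -> nth None u p = Some (inl c).
Proof.
case: p => [|p] [] //= _ Es; rewrite addSn => -[sz].
have lt_p : p < size w by rewrite -sz addnS ltnS leq_addr.
rewrite nth_rcons size_map lt_p (nth_map TEnd) //; congr (Some (inl _)).
by rewrite -[p]addn0 -nth_drop Es.
Qed.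

Lemma sits_lt p s : sits p s -> p < size u.
Proof. by case=> _ _ sz; rewrite size_tape_word ltnS -sz leq_addr. Qed.

Lemma goR_ok p : p.+1 < size u -> goR u p = p.+1.
Proof. by move=> lt_p; rewrite /goR; apply/minn_idPl; case: (size u) lt_p. Qed.

Lemma nth_lend p : p < size u -> (nth None u p != lend) = (0 < p).
Proof. by move=> lt_p; rewrite nth_u0 // lt0n. Qed.

Lemma emits_right (h : bool) c x y z v s :
  let ps := [:: x; y; z; v] in (nth 0 ps h).+1 < size u ->
  emits u c (upd S ps h) s -> emits u (Right h c) ps s.
Proof.
move=> ps lt_h H o; apply: runs_seq (runs_goR _ _ _ _) _.
apply: (runs_seq (st2 := (upd S ps h, s ++ o))).
  by have := H o; case: h lt_h {H} => lt_h /=; rewrite goR_ok.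
have {2}<- : upd goL (upd S ps h) h = ps by case: (h).
exact: runs_goL.
Qed.

Lemma emits_each (h : bool) c x y z v W :
  let ps := [:: x; y; z; v] in nth 0 ps h = 0 ->
  (forall i, i <= size w -> emits u c (upd (fun=> i) ps h) (W i)) ->
  emits u (Each h c) ps (flatten [seq W i | i <- iota 0 (size w).+1]).
Proof.
move=> ps h0 H; pose P i := upd (fun=> i) ps h.
have -> : ps = P 0 by rewrite /P /ps; case: (h) h0 => /= ->.
have Ph i : i <= (size w).+1 -> sym_at h (syms u (P i)) = nth None u i.
  by rewrite /P /ps; case: (h).
rewrite -[flatten _]cats0; apply: emits_loop => [i lei|i lei|i o lei|i o lei|i lei|].
- by rewrite Ph // nth_u_last ?size_tape_word // ltn_neqAle lei andbT.
- by rewrite Ph // nth_lend // size_tape_word ltnS.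
- have -> : P i.+1 = upd (goR u) (P i) h; last exact: runs_goR.
  by rewrite /P /ps; case: (h); rewrite /= goR_ok // size_tape_word !ltnS.
- have -> : P i = upd goL (P i.+1) h; last exact: runs_goL.
  by rewrite /P /ps; case: (h).
- exact: H.
- exact: emits_skip.
Qed.

Lemma emits_unary (h : bool) x y z :
  let ps := [:: x; y; z; 0] in nth 0 ps h < size u ->
  emits u (Unary h) ps (nseq (nth 0 ps h) (TBit true)).
Proof.
move=> ps; set p := nth 0 ps h => lt_p.
(* The two heads move in opposite directions, with constant sum [p]. *)
pose P i := upd (fun=> i) (upd (fun=> p - i) ps h) 3.
have -> : ps = P 0 by rewrite /P /p /ps; case: (h); rewrite /= subn0.
have -> : nseq p (TBit true) =
    flatten [seq [:: TBit true] | i <- iota 0 p] ++ [::].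
  by rewrite cats0; elim: (p) 0 => //= n IH m; rewrite -IH.
have lt_d i : p - i < size u by apply: leq_ltn_trans (leq_subr _ _) lt_p.
apply: emits_loop => [i lei|i lei|i o lei|i o lei|i lei|].
- have -> : sym_at h (syms u (P i)) = nth None u (p - i) by rewrite /P /ps; case: (h).
  by rewrite nth_lend // subn_gt0.
- have -> : sym_at 3 (syms u (P i)) = nth None u i by rewrite /P /ps; case: (h).
  by rewrite nth_lend // (leq_ltn_trans lei).
- have -> : P i.+1 = upd (goR u) (upd goL (P i) h) 3.
    by rewrite /P /ps; case: (h); rewrite /= goR_ok ?(leq_ltn_trans lei) // /goL subnS.
  exact: runs_seq (runs_goL _ _ _ _) (runs_goR _ _ _ _).
- have -> : P i = upd (goR u) (upd goL (P i.+1) 3) h.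
    by rewrite /P /ps; case: (h); rewrite /= goR_ok ?subnSK ?lt_d.
  exact: runs_seq (runs_goL _ _ _ _) (runs_goR _ _ _ _).
- exact: emits_put.
- exact: emits_skip.
Qed.

Lemma nth_name_sits p a r i : sits p (encode_name a ++ r) -> i <= size a ->
  nth None u (p + i) =
    Some (inl (if i < size a then TBit (nth false a i) else TEnd)).
Proof.
move=> sit lei; have : sits p (take i (encode_name a) ++
    nth TEnd (encode_name a) i :: drop i.+1 (encode_name a) ++ r).
  rewrite -cat_cons -drop_nth ?catA ?cat_take_drop //.
  by rewrite /encode_name size_rcons size_map ltnS.
move/sits_cat/sits_nth; rewrite size_takel; last first.
  by rewrite /encode_name size_rcons size_map ltnW.
rewrite -/u => ->; rewrite /encode_name nth_rcons size_map.
by case: ltngtP lei => // lti _; rewrite (nth_map false).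
Qed.

Lemma sits_name_lt p a r i : sits p (encode_name a ++ r) -> i <= size a ->
  p + i < size u.
Proof.
move=> /sits_cat/sits_lt + lei; apply: leq_ltn_trans.
by rewrite leq_add2l /encode_name size_rcons size_map ltnW.
Qed.

Lemma emits_name (h s : bool) f c a r x y z v W' :
  let ps := [:: x; y; z; v] in let p := nth 0 ps h in
  nth 0 ps (2 + s) = 0 -> sits p (encode_name a ++ r) ->
  emits u c (upd (fun=> size a) (upd (fun=> p + size a) ps h) (2 + s)) W' ->
  emits u (NameWalk h s f c) ps (flatten [seq f b | b <- a] ++ W').
Proof.
move=> ps p s0 sit H.
pose P i := upd (fun=> i) (upd (fun=> p + i) ps h) (2 + s).
have -> : ps = P 0.
  by move: s0; rewrite /P /p /ps; case: (h); case: (s); rewrite /= addn0 => ->.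
have Hp i : i <= size a -> _ := nth_name_sits sit.
have lt_p i : i <= size a -> p + i < size u := sits_name_lt sit.
have lt_i i : i <= size a -> i < size u.
  by move/lt_p; apply: leq_ltn_trans; apply: leq_addl.
have hP i : sym_at h (syms u (P i)) = nth None u (p + i).
  by rewrite /P /ps; case: (h); case: (s).
have -> : flatten [seq f b | b <- a] =
    flatten [seq f (nth false a i) | i <- iota 0 (size a)].
  by rewrite -[a in LHS](mkseq_nth false) /mkseq -map_comp.
apply: emits_loop => [i lei|i lei|i o lei|i o lei|i lei|] //.
- by rewrite hP Hp //; case: ltnP.
- have -> : sym_at (2 + s) (syms u (P i)) = nth None u i.
    by rewrite /P /ps; case: (h); case: (s).
  by rewrite nth_lend // lt_i.
- have -> : P i.+1 = upd (goR u) (upd (goR u) (P i) h) (2 + s).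
    have := goR_ok (lt_i _ lei); have : goR u (p + i) = p + i.+1.
      by have := lt_p _ lei; rewrite addnS => /goR_ok.
    by rewrite /P /p /ps; case: (h); case: (s) => /= -> ->.
  exact: runs_seq (runs_goR _ _ _ _) (runs_goR _ _ _ _).
- have -> : P i = upd goL (upd goL (P i.+1) (2 + s)) h.
    by rewrite /P /ps; case: (h); case: (s); rewrite /goL /= addnS.
  exact: runs_seq (runs_goL _ _ _ _) (runs_goL _ _ _ _).
- apply: emits_if; rewrite hP (Hp _ (ltnW lei)) lei.
  by case: (nth false a i); apply: emits_puts.
Qed.

(** The comparison walk stops after the longest common prefix; the names are equal exactly when both
    end there. *)
Lemma common_prefix (a b : name) : exists m,
  [/\ m <= size a, m <= size b,
      (forall i, i < m -> nth false a i = nth false b i),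
      (m < size a -> m < size b -> nth false a m <> nth false b m) &
      (m == size a) && (m == size b) = (a == b)].
Proof.
elim: a b => [|x a IH] [|y b]; try by exists 0.
have [|/eqP nxy] := eqVneq x y.
  move=> ->; have [m [la lb eq_ab neq_ab E]] := IH b; exists m.+1; split=> //.
  - by case=> [|i] //= /eq_ab.
  - by rewrite /= !eqSS E eqseq_cons eqxx.
by exists 0; split=> //=; rewrite eqseq_cons; case: eqP nxy.
Qed.

End Walks.

Section Compare.
Variable w : seq token.
Let u := tape_word w.

Lemma emits_compare a b x y z pi rho r1 r2 s1 s2 :
  (forall ps, emits u a ps s1) -> (forall ps, emits u b ps s2) ->
  sits w x (encode_name pi ++ r1) -> sits w y (encode_name rho ++ r2) ->
  emits u (Compare a b) [:: x; y; z; 0] (if pi == rho then s1 else s2).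
Proof.
move=> Ha Hb sx sy; have [m [lx ly eq_m neq_m E]] := common_prefix pi rho.
pose P i := [:: x + i; y + i; z; i].
have -> : [:: x; y; z; 0] = P 0 by rewrite /P !addn0.
have -> : (if pi == rho then s1 else s2) =
    flatten [seq [::] | i <- iota 0 m] ++ (if pi == rho then s1 else s2).
  by elim: m {eq_m neq_m E lx ly P} 0 => //= n IH k; rewrite -IH.
have hx i : i <= m -> _ := fun l => nth_name_sits sx (leq_trans l lx).
have hy i : i <= m -> _ := fun l => nth_name_sits sy (leq_trans l ly).
have bx i : i <= m -> x + i < size u := fun l => sits_name_lt sx (leq_trans l lx).
have by_ i : i <= m -> y + i < size u := fun l => sits_name_lt sy (leq_trans l ly).
have bi i : i <= m -> i < size u.
  by move/bx; apply: leq_ltn_trans; apply: leq_addl.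
apply: emits_loop => [i lei|i lei|i o lei|i o lei|i lei|].
- rewrite /= /sym_at /= -/u hx // hy //.
  case: (ltngtP i m) lei => // [lti|->] _.
    by rewrite (leq_trans lti lx) (leq_trans lti ly) eq_m ?eqxx.
  case: ltnP => // ltx; case: ltnP => lty /=; last by apply/eqP.
  by apply/negbTE/eqP => -[]; apply: neq_m.
- by rewrite /sym_at /= nth_lend ?bi.
- apply: runs_seq (runs_goR _ _ _ _) _; apply: runs_seq (runs_goR _ _ _ _) _.
  have gx : goR u (x + i) = x + i.+1.
    by have := bx _ lei; rewrite addnS => /goR_ok.
  have gy : goR u (y + i) = y + i.+1.
    by have := by_ _ lei; rewrite addnS => /goR_ok.
  rewrite /= gx gy.
  have -> : P i.+1 = upd (goR u) [:: x + i.+1; y + i.+1; z; i] 3.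
    by rewrite /= goR_ok ?bi.
  exact: runs_goR.
- apply: runs_seq (runs_goL _ _ _ _) _; apply: runs_seq (runs_goL _ _ _ _) _.
  have -> : P i = upd goL (upd goL (upd goL (P i.+1) 3) 1) 0.
    by rewrite /P /goL /= !addnS.
  exact: runs_goL.
- exact: emits_skip.
apply: emits_if; rewrite /sym_at /= -/u hx // hy // -E.
move: lx ly; rewrite [m <= size pi]leq_eqVlt [m <= size rho]leq_eqVlt.
case: (ltnP m (size pi)) => [ltx|lex]; first by rewrite (ltn_eqF ltx).
rewrite orbF => -> /=; case: (ltnP m (size rho)) => [lty|ley].
  by rewrite (ltn_eqF lty).
by rewrite orbF => ->.
Qed.

End Compare.

(** * Program pieces that mirror the target formula *)

Definition bits (s : seq bool) : seq token := [seq TBit b | b <- s].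

Definition cNeg (a : prog) : prog := Cat (Put TNeg) a.
Definition cOr (a b : prog) : prog := Cat (Put TOr) (Cat a b).
Definition cNext (a : prog) : prog := Cat (Put TNext) a.
Definition cUntil (a b : prog) : prog := Cat (Put TUntil) (Cat a b).
Definition cAnd (a b : prog) : prog := cNeg (cOr (cNeg a) (cNeg b)).
Definition cXor (a b : prog) : prog := cOr (cAnd a (cNeg b)) (cAnd (cNeg a) b).
Definition cTt : prog := Puts (encode_body Tt).
Definition cFf : prog := Puts (encode_body Ff).
Definition cEv (a : prog) : prog := cUntil cTt a.

Definition cAtom (tag : seq bool) (c : prog) (v : name) : prog :=
  Cat (Puts (TAtom :: bits tag)) (Cat c (Puts (TEnd :: encode_name v))).

Definition cLev (h : bool) : name -> prog :=
  cAtom [:: true; false] (Unary h).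

(** Head X passes the quantifier token, the name and its end token before its position is
    written. *)
Definition cLev_next : name -> prog :=
  cAtom [:: true; false]
    (Right headX (NameWalk headX false (fun=> [::]) (Right headX (Unary headX)))).

Definition cSt (i h : nat) : name -> prog :=
  cAtom [:: true; true]
    (Cat (Puts (bits (nseq i true))) (Cat (Unary headX)
       (Cat (Puts (bits (false :: nseq h true))) (Unary headY)))).

Definition cDom (h : bool) : name -> prog :=
  cAtom [:: false; false]
    (Right h (NameWalk h false (fun b => [:: TBit b]) (Do Nop))).

Definition cPair (h : bool) : name -> prog :=
  cAtom [:: false; true]
    (Right h (NameWalk h false (fun b => bits (dbl b))
       (Cat (Put (TBit false))
          (Right h (NameWalk h true (fun b => [:: TBit b]) (Do Nop)))))).

(** X goes to the quantified variable; Y skips the proposition of the atom and stops at its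
    variable. *)
Definition cSame : prog :=
  Right headX (Right headY (NameWalk headY false (fun=> [::])
    (Right headY (Compare cTt cFf)))).

Definition cTop (c : token) : prog :=
  match c with
  | TAtom => cPair headX vp
  | TNeg => cNeg (cSt 1 0 vp)
  | TOr => cOr (cSt 1 0 vp) (cSt 1 1 vp)
  | TNext => cNext (cSt 1 0 vp)
  | TUntil => cUntil (cSt 1 0 vp) (cSt 1 1 vp)
  | _ => cSt 1 0 vp
  end.

Definition cViol (a : prog) : prog := Cat (Put TOr) a.

Definition cStack (c : token) : prog :=
  Cat (cViol (cAnd (cLev headX vp) (cNeg (cSt 0 0 vp))))
  (Cat (cViol (cEv (cXor (cSt 0 0 vp) (cTop c))))
    (Each headY (cViol (cEv (cXor (cSt 0 1 vp) (cSt 1 (arity c) vp)))))).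

Definition cPairs (r : name) : prog :=
  Cat (cViol (cAnd (cLev headX vp)
         (cAnd cSame (cEv (cXor (cPair headY vt) (cDom headY r))))))
    (cViol (cAnd (cLev headX vp)
         (cAnd (cNeg cSame) (cEv (cXor (cPair headY vt) (cPair headY vp)))))).

Definition cQuant (r : name) : prog :=
  Cat (cViol (cAnd (cLev headX vp) (cNeg (cLev_next vt))))
    (Each headY (If (fun r => if sym_at 1 r is Some (inl TAtom) then true else false)
       (cPairs r) (Do Nop))).

Definition cAt (c : token) : prog :=
  match c with
  | TExists => cQuant vt
  | TForall => cQuant vq
  | c => cStack c
  end.

Definition tokens : seq token :=
  [:: TExists; TForall; TAtom; TNeg; TOr; TNext; TUntil; TBit false; TBit true; TEnd].

Definition cDispatch : prog :=
  foldr (fun c => If (fun r => sym_at 0 r == Some (inl c)) (cAt c)) (Do Nop) tokens.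

Definition target_prefix : seq token :=
  TForall :: encode_name vp ++ TForall :: encode_name vq ++
  TExists :: encode_name vt ++ TExists :: encode_name vi ++
  [:: TNeg, TOr, TNeg & encode_body (At (Lev 1) vi)].

Definition cTarget : prog :=
  Cat (Puts target_prefix)
    (Cat (Each headX cDispatch) cFf).

Definition enc_viols (vs : seq body) : seq token :=
  flatten [seq TOr :: encode_body v | v <- vs].

Lemma enc_viols_cat vs1 vs2 : enc_viols (vs1 ++ vs2) = enc_viols vs1 ++ enc_viols vs2.
Proof. by rewrite /enc_viols map_cat flatten_cat. Qed.

Lemma enc_viols_flatten vss :
  enc_viols (flatten vss) = flatten [seq enc_viols vs | vs <- vss].
Proof. by elim: vss => //= vs vss IH; rewrite enc_viols_cat IH. Qed.

(** In Polish notation a right-nested disjunction has no closing symbols, so each violation can be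
    written independently of the others. *)
Lemma encode_foldr_Or vs :
  encode_body (foldr Or Ff vs) = enc_viols vs ++ encode_body Ff.
Proof. by elim: vs => //= v vs ->; rewrite /enc_viols /= -catA. Qed.

(** The only property of encodings on which the correctness of the program relies. *)
Fixpoint well_formed (w : seq token) : Prop :=
  match w with
  | [::] => True
  | c :: w' => well_formed w' /\
      match c with
      | TAtom => exists a rho r, w' = encode_name a ++ encode_name rho ++ r
      | TExists | TForall => exists pi r, w' = encode_name pi ++ r
      | _ => True
      end
  end.

Lemma well_formed_name x w : well_formed w -> well_formed (encode_name x ++ w).
Proof. by elim: x => //= b x IH /IH. Qed.

Lemma well_formed_body psi w : well_formed w -> well_formed (encode_body psi ++ w).
Proof.
elim: psi w => [a v|p IH|p IHp q IHq|p IH|p IHp q IHq] w wf /=; split=> //;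
  rewrite -?catA; auto.
- by apply/well_formed_name/well_formed_name.
- by exists a, v, w.
Qed.

Lemma well_formed_encode phi : well_formed (encode phi).
Proof.
elim: phi => [pi phi IH|pi phi IH|psi] /=.
- by split; [apply: well_formed_name|exists pi, (encode phi)].
- by split; [apply: well_formed_name|exists pi, (encode phi)].
- by rewrite -[encode_body psi]cats0; apply: well_formed_body.
Qed.

Lemma well_formed_drop i w : well_formed w -> well_formed (drop i w).
Proof. by elim: i w => [|i IH] [|c w] //= [/IH]. Qed.

(** * Correctness of the program *)

Section Program.
Variable w : seq token.
Let u := tape_word w.
Hypothesis wf : well_formed w.

Definition emits_body (c : prog) ps psi := emits u c ps (encode_body psi).
Definition emits_viols (c : prog) ps vs := emits u c ps (enc_viols vs).

Lemma eb_neg a ps x : emits_body a ps x -> emits_body (cNeg a) ps (Neg x).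
Proof. exact: emits_cat (emits_put _ _ _). Qed.

Lemma eb_or a b ps x y :
  emits_body a ps x -> emits_body b ps y -> emits_body (cOr a b) ps (Or x y).
Proof. by move=> Ha Hb; apply: emits_cat (emits_put _ _ _) (emits_cat Ha Hb). Qed.

Lemma eb_next a ps x : emits_body a ps x -> emits_body (cNext a) ps (Next x).
Proof. exact: emits_cat (emits_put _ _ _). Qed.

Lemma eb_until a b ps x y :
  emits_body a ps x -> emits_body b ps y -> emits_body (cUntil a b) ps (Until x y).
Proof. by move=> Ha Hb; apply: emits_cat (emits_put _ _ _) (emits_cat Ha Hb). Qed.

Lemma eb_and a b ps x y :
  emits_body a ps x -> emits_body b ps y -> emits_body (cAnd a b) ps (And x y).
Proof. by move=> Ha Hb; apply/eb_neg/eb_or; apply: eb_neg. Qed.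

Lemma eb_xor a b ps x y :
  emits_body a ps x -> emits_body b ps y -> emits_body (cXor a b) ps (Xor x y).
Proof.
move=> Ha Hb; apply: eb_or; first by apply: eb_and => //; apply: eb_neg.
by apply: eb_and => //; apply: eb_neg.
Qed.

Lemma eb_ev a ps x : emits_body a ps x -> emits_body (cEv a) ps (Ev x).
Proof. by apply: eb_until; apply: emits_puts. Qed.

Lemma ev_viol a ps x : emits_body a ps x -> emits_viols (cViol a) ps [:: x].
Proof.
move=> Ha; rewrite /emits_viols /enc_viols /= cats0.
exact: emits_cat (emits_put _ _ _) Ha.
Qed.

Lemma ev_cat a b ps vs1 vs2 : emits_viols a ps vs1 -> emits_viols b ps vs2 ->
  emits_viols (Cat a b) ps (vs1 ++ vs2).
Proof. by move=> Ha Hb; rewrite /emits_viols enc_viols_cat; apply: emits_cat. Qed.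

Lemma ev_each (h : bool) c x y z v vs :
  let ps := [:: x; y; z; v] in nth 0 ps h = 0 ->
  (forall i, i <= size w -> emits_viols c (upd (fun=> i) ps h) (vs i)) ->
  emits_viols (Each h c) ps (flatten [seq vs i | i <- iota 0 (size w).+1]).
Proof.
move=> ps h0 H; rewrite /emits_viols enc_viols_flatten -map_comp.
exact: emits_each.
Qed.

Lemma eb_atom tag c ps v s :
  emits u c ps (bits s) -> emits_body (cAtom tag c v) ps (Atom (tag ++ s) v).
Proof.
move=> Hc; rewrite /emits_body.
have -> : encode_body (Atom (tag ++ s) v) =
    (TAtom :: bits tag) ++ bits s ++ TEnd :: encode_name v.
  by rewrite /= /encode_name -!cats1 -!catA /bits map_cat -!catA.
exact: emits_cat (emits_puts _ _ _) (emits_cat Hc (emits_puts _ _ _)).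
Qed.

Lemma nseq_bits n : nseq n (TBit true) = bits (nseq n true).
Proof. by rewrite /bits map_nseq. Qed.

Lemma emits_unary_bits (h : bool) x y z :
  let ps := [:: x; y; z; 0] in nth 0 ps h < size u ->
  emits u (Unary h) ps (bits (nseq (nth 0 ps h) true)).
Proof. by move=> ps lt_h; rewrite -nseq_bits; apply: emits_unary. Qed.

Lemma eb_lev (h : bool) x y v : nth 0 [:: x; y] h < size u ->
  emits_body (cLev h v) [:: x; y; 0; 0] (At (Lev (nth 0 [:: x; y] h)) v).
Proof.
move=> lt_h; apply: (@eb_atom [:: true; false]).
case: h lt_h => lt_h; first exact: (@emits_unary_bits headY).
exact: (@emits_unary_bits headX).
Qed.

Lemma eb_st i h x y v : x < size u -> y < size u ->
  emits_body (cSt i h v) [:: x; y; 0; 0] (At (St (i + x) (h + y)) v).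
Proof.
move=> ltx lty; apply: (@eb_atom [:: true; true]).
rewrite !nseqD -catA -cat_cons /bits !map_cat.
apply: emits_cat (emits_puts _ _ _) _.
apply: emits_cat (@emits_unary_bits headX _ _ _ _) _ => //.
exact: emits_cat (emits_puts _ _ _) (@emits_unary_bits headY _ _ _ _).
Qed.

Lemma flatten_nil (T S : Type) (s : seq S) : flatten [seq ([::] : seq T) | _ <- s] = [::].
Proof. by elim: s. Qed.

Lemma flatten_bits (a : name) : flatten [seq [:: TBit b] | b <- a] = bits a.
Proof. by elim: a => //= b a ->. Qed.

Lemma sits_name_end p a r :
  sits w p (encode_name a ++ r) -> sits w (p + size a) (TEnd :: r).
Proof. by rewrite /encode_name cat_rcons => /sits_cat; rewrite size_map. Qed.

Lemma eb_lev_next x y c pi r v : sits w x (c :: encode_name pi ++ r) ->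
  (x + size pi).+2 < size u ->
  emits_body (cLev_next v) [:: x; y; 0; 0] (At (Lev (x + size pi).+2) v).
Proof.
move=> sit lt_x; apply: (@eb_atom [:: true; false]).
apply: emits_right; first exact: (sits_lt (sits_cons sit)).
have sit1 := sits_cons sit.
have -> : bits (nseq (x + size pi).+2 true) =
    flatten [seq [::] | _ <- pi] ++ bits (nseq (x + size pi).+2 true).
  by rewrite flatten_nil.
apply: (@emits_name _ headX false _ _ _ _ x.+1 y 0 0 _ erefl sit1).
apply: (@emits_right _ headX) => //.
exact: (@emits_unary_bits headX (x.+1 + size pi).+1).
Qed.

Lemma eb_dom (h : bool) x y c a r v :
  sits w (nth 0 [:: x; y] h) (c :: encode_name a ++ r) ->
  emits_body (cDom h v) [:: x; y; 0; 0] (At (Dom a) v).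
Proof.
move=> sit; apply: (@eb_atom [:: false; false]).
have sit1 := sits_cons sit; rewrite -[bits a]cats0 -flatten_bits.
case: h sit sit1 => sit sit1; (apply: emits_right; first exact: (sits_lt (sits_cons sit))).
  by apply: (@emits_name _ headY false _ _ _ _ x y.+1 0 0 _ erefl sit1); apply: emits_skip.
by apply: (@emits_name _ headX false _ _ _ _ x.+1 y 0 0 _ erefl sit1); apply: emits_skip.
Qed.

Lemma eb_pair (h : bool) x y c a rho r v :
  sits w (nth 0 [:: x; y] h) (c :: encode_name a ++ encode_name rho ++ r) ->
  emits_body (cPair h v) [:: x; y; 0; 0] (At (Pair a rho) v).
Proof.
move=> sit; apply: (@eb_atom [:: false; true]).
have sit1 := sits_cons sit; have sit2 := sits_name_end sit1.
have sit3 := sits_cons sit2.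
have -> : bits (flatten [seq dbl b | b <- a] ++ false :: rho) =
    flatten [seq bits (dbl b) | b <- a] ++
      [:: TBit false] ++ flatten [seq [:: TBit b] | b <- rho] ++ [::].
  rewrite /bits map_cat cats0 flatten_bits; congr (_ ++ _).
  by elim: (a) => //= b a' ->.
case: h sit sit1 sit2 sit3 => sit sit1 sit2 sit3;
  (apply: emits_right; first exact: (sits_lt (sits_cons sit))).
  apply: (@emits_name _ headY false _ _ _ _ x y.+1 0 0 _ erefl sit1).
  apply: emits_cat (emits_put _ _ _) _.
  apply: (@emits_right _ headY); first exact: (sits_lt (sits_cons sit2)).
  by apply: (@emits_name _ headY true _ _ _ _ x _ _ 0 _ erefl sit3); apply: emits_skip.
apply: (@emits_name _ headX false _ _ _ _ x.+1 y 0 0 _ erefl sit1).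
apply: emits_cat (emits_put _ _ _) _.
apply: (@emits_right _ headX); first exact: (sits_lt (sits_cons sit2)).
by apply: (@emits_name _ headX true _ _ _ _ _ y _ 0 _ erefl sit3); apply: emits_skip.
Qed.

Lemma eb_same x y c1 c2 pi r1 a rho r2 : sits w x (c1 :: encode_name pi ++ r1) ->
  sits w y (c2 :: encode_name a ++ encode_name rho ++ r2) ->
  emits_body cSame [:: x; y; 0; 0] (if pi == rho then Tt else Ff).
Proof.
move=> sitx sity; have sitx1 := sits_cons sitx.
have sity1 := sits_cons sity; have sity2 := sits_name_end sity1.
apply: (@emits_right _ headX); first exact: (sits_lt (sits_cons sitx)).
apply: (@emits_right _ headY); first exact: (sits_lt (sits_cons sity)).
have -> : encode_body (if pi == rho then Tt else Ff) =
    flatten [seq [::] | _ <- a] ++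
      (if pi == rho then encode_body Tt else encode_body Ff).
  by rewrite flatten_nil; case: ifP.
apply: (@emits_name _ headY false _ _ _ _ x.+1 y.+1 0 0 _ erefl sity1).
apply: (@emits_right _ headY); first exact: (sits_lt (sits_cons sity2)).
apply: emits_compare sitx1 (sits_cons sity2); move=> ps; exact: emits_puts.
Qed.

Lemma sits_well_formed p c v : sits w p (c :: v) -> well_formed (c :: v).
Proof. by case=> + <- _; case: p => // p _; apply: well_formed_drop. Qed.

Lemma eb_top x c v : sits w x (c :: v) ->
  emits_body (cTop c) [:: x; 0; 0; 0] (stack_top x c v).
Proof.
move=> sit; have lt_x := sits_lt (sits_cons sit).
have lt_x' : x < size u by rewrite ltnW.
have u2 : 1 < size u by rewrite size_tape_word.
have S0 : emits_body (cSt 1 0 vp) [:: x; 0; 0; 0] (At (St x.+1 0) vp).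
  by apply: (@eb_st 1 0) => //; apply: ltnW.
have S1 : emits_body (cSt 1 1 vp) [:: x; 0; 0; 0] (At (St x.+1 1) vp).
  by apply: (@eb_st 1 1) => //; apply: ltnW.
have wfc := sits_well_formed sit.
case: c sit wfc => [||sit [_ [a [rho [r Ev]]]]|||||b|] //=;
  auto using eb_neg, eb_or, eb_next, eb_until.
rewrite Ev in sit *; rewrite take_nameE drop_nameE take_nameE.
exact: (@eb_pair headX) sit.
Qed.

Lemma ev_stack x c v : sits w x (c :: v) ->
  emits_viols (cStack c) [:: x; 0; 0; 0] (stack_viol (size w) x c v).
Proof.
move=> sit; have lt_x := sits_lt (sits_cons sit).
have lt_x' : x < size u by rewrite ltnW.
have u0 : 0 < size u by rewrite size_tape_word.
have S0 : emits_body (cSt 0 0 vp) [:: x; 0; 0; 0] (At (St x 0) vp).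
  exact: (@eb_st 0 0).
apply: (@ev_cat _ _ _ [:: _] (_ :: _)).
  by apply/ev_viol/eb_and/eb_neg => //; apply: (@eb_lev headX).
apply: (@ev_cat _ _ _ [:: _]); first by apply/ev_viol/eb_ev/eb_xor/eb_top.
(* The family over the depths is read as a concatenation of singletons, the form in which a loop
   produces it. *)
rewrite -[X in emits_viols _ _ X]flatten_seq1 -map_comp.
apply: (@ev_each headY) => // h leh; apply/ev_viol/eb_ev.
have lt_h : h < size u by rewrite size_tape_word ltnS leqW.
by rewrite /= addnC; apply: eb_xor; [apply: (@eb_st 0 1)|apply: (@eb_st 1)].
Qed.

Lemma ev_pairs x y r c1 pi r1 c2 a rho r2 :
  sits w x (c1 :: encode_name pi ++ r1) ->
  sits w y (c2 :: encode_name a ++ encode_name rho ++ r2) ->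
  emits_viols (cPairs r) [:: x; y; 0; 0] (pair_viol x r pi a rho).
Proof.
move=> sitx sity; have lt_x := sits_lt sitx.
have L : emits_body (cLev headX vp) [:: x; y; 0; 0] (At (Lev x) vp).
  exact: (@eb_lev headX).
have E := eb_same sitx sity.
have P v : emits_body (cPair headY v) [:: x; y; 0; 0] (At (Pair a rho) v).
  exact: (@eb_pair headY) sity.
have D v : emits_body (cDom headY v) [:: x; y; 0; 0] (At (Dom a) v).
  exact: (@eb_dom headY) sity.
apply: (@ev_cat _ _ _ [:: _]); apply/ev_viol/eb_and => //; apply: eb_and => //.
- exact/eb_ev/eb_xor.
- exact/eb_neg.
- exact/eb_ev/eb_xor.
Qed.

Lemma sits_at j : j <= size w -> j = 0 \/ exists c v, sits w j (c :: v).
Proof.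
case: j => [|p] lt_p; first by left.
right; exists (nth TEnd w p), (drop p.+1 w); split=> //=.
  by rewrite -drop_nth.
by rewrite size_drop -subSn // subSS addSn subnKC // ltnW.
Qed.

Lemma ev_quant x r c pi r1 : sits w x (c :: encode_name pi ++ r1) ->
  emits_viols (cQuant r) [:: x; 0; 0; 0] (quant_viol w x r (encode_name pi ++ r1)).
Proof.
move=> sit; rewrite /quant_viol take_nameE.
have lt_x := sits_lt sit.
(* The position after the end token is still on the tape, at worst on the right end marker. *)
have lt_next : (x + size pi).+2 < size u.
  by have := sits_lt (sits_cons (sits_name_end (sits_cons sit))); rewrite addSn.
apply: (@ev_cat _ _ _ [:: _]).
  apply/ev_viol/eb_and; first exact: (@eb_lev headX).
  exact/eb_neg/(eb_lev_next _ _ sit).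
apply: (@ev_each headY) => // j lej; apply: emits_if.
case: (sits_at lej) => [->|[c' [v' sity]]]; first exact: emits_skip.
have := sits_nth sity; rewrite /sym_at /= => ->.
have [_ -> _] := sity; have := sits_well_formed sity.
case: c' sity => [||sity [_ [a [rho [r2 Ev]]]]|||||b|] *; try exact: emits_skip.
rewrite Ev in sity *; rewrite take_nameE drop_nameE take_nameE.
exact: ev_pairs sit sity.
Qed.

Lemma emits_dispatch x c v s : sits w x (c :: v) ->
  emits u (cAt c) [:: x; 0; 0; 0] s -> emits u cDispatch [:: x; 0; 0; 0] s.
Proof.
move=> /sits_nth Ex H.
have : c \in tokens by case: c {Ex H} => [||||||| []|]; rewrite !inE eqxx ?orbT.
rewrite /cDispatch; elim: tokens => //= c' cs IH; rewrite inE => c_in.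
apply: emits_if; rewrite /sym_at /= -/u Ex; case: eqP => [[<-]|ncc'] //.
by apply: IH; case/predU1P: c_in => // Ec; case: ncc'; rewrite Ec.
Qed.

Lemma ev_dispatch x : x <= size w ->
  emits_viols cDispatch [:: x; 0; 0; 0] (viol_at w x).
Proof.
case/sits_at=> [->|[c [v sit]]].
  rewrite /cDispatch; elim: tokens => [|c cs IH] /=; first exact: emits_skip.
  by apply: emits_if; case: eqP.
apply: emits_dispatch (sit) _; have := sits_well_formed sit.
rewrite /viol_at; have [_ -> _] := sit.
case: c sit => [sit [_ [pi [r Ev]]]|sit [_ [pi [r Ev]]]|sit _|sit _|sit _|
  sit _|sit _|b sit _|sit _];
  try exact: ev_stack sit.
- by rewrite Ev in sit *; apply: ev_quant sit.
- by rewrite Ev in sit *; apply: ev_quant sit.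
Qed.

Lemma emits_target : emits u cTarget (nseq 4 0) (encode (target w)).
Proof.
have -> : encode (target w) =
    target_prefix ++ enc_viols (viols w) ++ encode_body Ff.
  by rewrite -encode_foldr_Or.
apply: emits_cat (emits_puts _ _ _) _.
apply: emits_cat _ (emits_puts _ _ _).
by apply: (@ev_each headX) => // i lei; apply: ev_dispatch.
Qed.

End Program.

Theorem theorem4 :
  exists f : sentence -> sentence,
    polytime_computable encode_sentence encode_sentence f /\
    forall phi : sentence,
      [/\ forall2_exists_form (f phi),
          td (f phi) <= 2 &
          forall AP AP' : {fset name},
            (props phi `<=` AP)%fset -> (props (f phi) `<=` AP')%fset ->
            (satisfiable AP phi <-> satisfiable AP' (f phi))].
Proof.
exists target_sentence; split.
  (* Four heads: X, Y and the two scratch heads, all back on the left end marker when the program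
     stops. *)
  apply: (@transducer_polytime 4 cTarget) => // [phi|phi].
    by case: phi => -[pi phi|pi phi|[]].
  exists (nseq 4 0); have := emits_target (well_formed_encode phi) [::].
  by rewrite cats0.
move=> phi; split; first by exists vp, vq, [:: vt; vi], (matrix_of (encode phi)).
  exact: target_td.
move=> AP AP' sub sub'; split; first exact: target_complete.
exact: target_sound.
Qed.
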